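(* Let $n \geq 1$ and suppose $X_1,\ldots,X_n$ are i.i.d. log-concave random variables on the integers with common variance $\sigma^2$ (with $\sigma\ge 0$). Let $U_1,\ldots,U_n$ be i.i.d. continuous uniform random variables on $(0,1)$, independent of $(X_1,\ldots,X_n)$. Then $$h(X_1+\cdots+X_n+U_1+\cdots+U_n) = H(X_1+\cdots+X_n) + o(1),$$ where, for each fixed $n$, the $o(1)$-term vanishes as $\sigma^2 \to \infty$ (at a rate depending on $n$). In fact, provided that $\sigma > \max\{2^{n+2}/\sqrt{n},\,3^7/\sqrt{n}\}$, $$\bigl|h(X_1+\cdots+X_n+U_1+\cdots+U_n) - H(X_1+\cdots+X_n)\bigr| \leq 2^{n+6} e^{-(\sqrt{n}\sigma)^{1/5}} (\sqrt{n}\sigma)^{3} + \frac{2^{n+2}}{\sigma\sqrt{n}}\log\bigl(2^{n+2}\sigma\sqrt{n}\bigr) +\frac{\log(n\sigma^2)}{8n\sigma^2}.$$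
   Context: $\log$ is the natural logarithm. For an integer-valued random variable $X$ with probability mass function $p$, the Shannon entropy is $H(X) = -\sum_{k\in\mathbb{Z}} p(k)\log p(k)$ (with $0\log 0=0$). For a real random variable $Y$ with density $f$, the differential entropy is $h(Y) = -\int_{\mathbb{R}} f(x)\log f(x)\,dx$. A random variable on the integers with p.m.f. $p$ is log-concave if $p(k)^2 \geq p(k-1)p(k+1)$ for all $k\in\mathbb{Z}$ and its support $\{k\in\mathbb{Z} : p(k)>0\}$ is connected, i.e. is a set of consecutive integers. Log-concave random variables on the integers have finite moments of all orders. *)

(* Defs.v *)
From HB Require Import structures.
From mathcomp Require Import all_boot all_order all_algebra.
From mathcomp Require Import all_classical all_reals all_analysis measurable_realfun.
Set Implicit Arguments.
Unset Strict Implicit.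
Unset Printing Implicit Defensive.
Import Order.TTheory GRing.Theory Num.Theory.
Import numFieldNormedType.Exports.
Local Open Scope classical_set_scope.
Local Open Scope ring_scope.

Section entropy.
Context {d : measure_display} {T : measurableType d} {R : realType}
  (P : probability T R).

(* Random variables on the integers are represented as real random variables
   with integer values, so that expectation, variance and sums are those of the
   library. *)
Definition int_valued (X : {RV P >-> R}) : Prop :=
  forall t, X t \is a Num.int.

Definition pmfZ (X : {RV P >-> R}) (k : int) : R := pmf X k%:~R.

(* The terms are nonnegative, so the sum always makes sense in \bar R;
   ln 0 = 0, hence also 0 log 0 = 0. *)
Definition shannon_entropy (X : {RV P >-> R}) : \bar R :=
  (\esum_(k in [set: int]) (- (pmfZ X k * ln (pmfZ X k)))%:E)%E.

Definition is_density (Y : {RV P >-> R}) (f : R -> R) : Prop :=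
  [/\ measurable_fun [set: R] f,
      (forall x, 0 <= f x) &
      forall A : set R, measurable A ->
        distribution P Y A = (\int[lebesgue_measure]_(x in A) (f x)%:E)%E].

Definition log_concave (X : {RV P >-> R}) : Prop :=
  int_valued X /\
  (forall k : int, pmfZ X (k - 1) * pmfZ X (k + 1) <= pmfZ X k ^+ 2) /\
  (forall i j k : int, i <= j -> j <= k ->
     0 < pmfZ X i -> 0 < pmfZ X k -> 0 < pmfZ X j).

(* Since the A i may be the whole space, the product rule for the full family
   contains the product rule for every subfamily. *)
Definition mutually_independent (n : nat) (X : 'I_n -> {RV P >-> R}) : Prop :=
  forall A : 'I_n -> set R, (forall i, measurable (A i)) ->
    P [set t | forall i, A i (X i t)] = (\prod_(i < n) P (X i @^-1` A i))%E.

Definition identically_distributed (n : nat) (X : 'I_n -> {RV P >-> R}) : Prop :=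
  forall (i j : 'I_n) (A : set R), measurable A ->
    distribution P (X i) A = distribution P (X j) A.

Definition iid (n : nat) (X : 'I_n -> {RV P >-> R}) : Prop :=
  mutually_independent X /\ identically_distributed X.

Definition random_vector (n : nat) (X : 'I_n -> {RV P >-> R}) (t : T) :
    n.-tuple R := [tuple X i t | i < n].

Definition independent_vectors (n m : nat)
    (X : 'I_n -> {RV P >-> R}) (Y : 'I_m -> {RV P >-> R}) : Prop :=
  forall (A : set (n.-tuple R)) (B : set (m.-tuple R)),
    measurable A -> measurable B ->
    P (random_vector X @^-1` A `&` random_vector Y @^-1` B) =
    (P (random_vector X @^-1` A) * P (random_vector Y @^-1` B))%E.

(* The library's uniform law lives on [0, 1]; it coincides with that on
   (0, 1). *)
Definition uniform01 (U : {RV P >-> R}) : Prop :=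
  forall A : set R, measurable A ->
    distribution P U A = uniform_prob (@ltr01 R) A.

Definition sumRV (n : nat) (X : 'I_n -> {RV P >-> R}) : {RV P >-> R} :=
  \sum_(i < n) (X i : {mfun T >-> R}).

Definition addRV (X Y : {RV P >-> R}) : {RV P >-> R} :=
  (X : {mfun T >-> R}) + (Y : {mfun T >-> R}).

Definition log_concave_setup (n : nat) (X U : 'I_n -> {RV P >-> R}) (v : R) :
    Prop :=
  [/\ iid X /\ (forall i, log_concave (X i)),
      forall i, ('V_P[X i] = v%:E)%E,
      iid U /\ (forall i, uniform01 (U i)) &
      independent_vectors X U].

End entropy.

(* Intended for a density f.  The value is +oo when both the positive and the
   negative part of f log f have infinite integral.  In \bar R one has
   `|+oo - +oo| = `|-oo - -oo| = +oo, so a real upper bound on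
   `|differential_entropy f - shannon_entropy X| entails that both entropies
   are finite. *)
Definition differential_entropy {R : realType} (f : R -> R) : \bar R :=
  (- \int[lebesgue_measure]_x (f x * ln (f x))%:E)%E.

(* Main.v *)
(** Put S = X_1 + ... + X_n, p its probability mass function, and W the sum of
    the first n - 1 uniform variables.  Conditioning on the last uniform
    variable, S + W + U_n has density f(x) = P(x - 1 < S + W <= x), and since
    0 <= W <= n - 1, f(x) is a weighted mean of p(k), p(k - 1), ...,
    p(k - n + 1), where k = floor x.  The convolution of log-concave sequences
    is log-concave, so p is unimodal; eta(x) = - x ln x is nondecreasing on
    [0, 1/e], so once max p <= 1/e the sequence eta(p(k)) is unimodal as well,
    and replacing it by its minima or maxima over windows of length n changes
    its sum by at most (n - 1) eta(max p).  Hence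
    |h(f) - H(p)| <= (n - 1) eta(max p).  Finally max p is at most the maximum
    M of the mass function of X_n, and a log-concave tail halves every
    N <= 2/M steps, which gives sigma^2 <= 72/M^2.  Only the middle term of the
    explicit bound is needed. *)

Require Import Defs.
From HB Require Import structures.
From mathcomp Require Import all_boot all_order all_algebra finmap zify ring lra.
From mathcomp Require Import all_classical all_reals all_analysis measurable_realfun.
Set Implicit Arguments.
Unset Strict Implicit.
Unset Printing Implicit Defensive.
Import Order.TTheory GRing.Theory Num.Theory.
Import numFieldNormedType.Exports.
Local Open Scope classical_set_scope.
Local Open Scope ring_scope.

(** * Sums over the integers *)

Section esum_int.
Context {R : realType}.
Local Open Scope ereal_scope.

(** The enumeration 0, -1, 1, -2, ...; it turns sums over the integers into series, to which
    countable additivity applies. *)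
Definition int_of_nat (k : nat) : int := if odd k then Negz k./2 else Posz k./2.

Lemma int_of_nat_bij : set_bij [set: nat] [set: int] int_of_nat.
Proof.
split => //.
  move=> m k _ _; rewrite /int_of_nat.
  move: (odd_double_half m) (odd_double_half k).
  by case: (odd m); case: (odd k) => //= Em Ek [E]; rewrite -Em -Ek E.
move=> [k|k] _; [exists k.*2|exists k.*2.+1] => //=; rewrite /int_of_nat/=.
  by rewrite odd_double doubleK.
by rewrite odd_double/= uphalf_double.
Qed.

Lemma esum_int_nneseries (f : int -> \bar R) : (forall k, 0 <= f k) ->
  \esum_(k in [set: int]) f k = \sum_(k <oo) f (int_of_nat k).
Proof. by move=> f0; rewrite (reindex_esum _ _ _ _ int_of_nat_bij) nneseries_esumT. Qed.

Lemma esumZl (I : choiceType) (D : set I) (c : R) (f : I -> \bar R) :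
  (0 <= c)%R -> (forall i, 0 <= f i) ->
  \esum_(i in D) (c%:E * f i) = c%:E * \esum_(i in D) f i.
Proof.
move=> c0 f0; rewrite /esum -ereal_supZl//; last first.
  by apply/set0P; exists 0; exists set0; [exact: fsets_set0|rewrite fsbig_set0].
congr ereal_sup; apply/seteqP; split=> x /=.
  move=> [A [fA AD] <-]; exists (\sum_(i \in A) f i); first by exists A.
  by rewrite ge0_mule_fsumr.
by move=> [_ [A [fA AD] <-] <-]; exists A => //; rewrite ge0_mule_fsumr.
Qed.

Lemma esumM (I J : choiceType) (f : I -> R) (g : J -> R) (a b : R) :
  (forall i, 0 <= f i)%R -> (forall j, 0 <= g j)%R ->
  \esum_(i in [set: I]) (f i)%:E = a%:E ->
  \esum_(j in [set: J]) (g j)%:E = b%:E ->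
  \esum_(k in [set: I * J]) (f k.1 * g k.2)%:E = (a * b)%:E.
Proof.
move=> f0 g0 fa gb; have b0 : (0 <= b)%R.
  by rewrite -lee_fin -gb esum_ge0// => j _; rewrite lee_fin.
transitivity (\esum_(i in [set: I]) \esum_(j in [set: J]) (f i * g j)%:E).
  rewrite esum_esum; last by move=> i j _ _; rewrite lee_fin mulr_ge0.
  by congr esum; apply/seteqP; split.
transitivity (\esum_(i in [set: I]) (b%:E * (f i)%:E)).
  apply: eq_esum => i _; under eq_esum do rewrite EFinM.
  by rewrite esumZl// gb muleC.
by rewrite esumZl// fa EFinM muleC.
Qed.

Lemma esum_shift (c : int) (f : int -> \bar R) :
  \esum_(k in [set: int]) f (k + c)%R = \esum_(k in [set: int]) f k.
Proof.
rewrite [RHS](reindex_esum [set: int] _ (fun k => k + c)%R)//; split => //.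
  by move=> i j _ _ /addIr.
by move=> k _; exists (k - c)%R => //; rewrite subrK.
Qed.

Lemma esum_opp (f : int -> \bar R) :
  \esum_(k in [set: int]) f (- k)%R = \esum_(k in [set: int]) f k.
Proof.
by rewrite [RHS](reindex_esum [set: int] _ -%R).
Qed.

Lemma esum_int_sum_nat (f : int -> \bar R) (g : nat -> int) (K : nat) :
  injective g ->
  \sum_(i < K) f (g i) <= \esum_(k in [set: int]) f k.
Proof.
move=> gI; apply: esum_ge; exists (g @` `I_K).
  by split => //; apply: finite_image; exact: finite_II.
rewrite fsbig_image; last by move=> ? ? _ _; exact: gI.
by rewrite (fsbig_ord _ _ (fun i => f (g i))).
Qed.

Lemma esum_int_split (f : int -> \bar R) : (forall k, 0 <= f k) ->
  \esum_(k in [set: int]) f k =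
  \sum_(i <oo) f i%:Z + \sum_(i <oo) f (- i.+1%:Z)%R.
Proof.
move=> f0; rewrite (esumID [set k : int | (0 <= k)%R])//; congr (_ + _).
  rewrite nneseries_esumT//; apply: reindex_esum; split => //=.
  - by move=> i j _ _ [].
  - by move=> k [_ /= k0]; exists `|k|%N => //=; rewrite gez0_abs.
rewrite nneseries_esumT//; apply: reindex_esum; split => /=.
- by move=> i _; split => //=; lia.
- by move=> i j _ _; lia.
- by move=> k [_ /= k0]; exists `|k|%N.-1 => //; lia.
Qed.
End esum_int.

(** * Log-concave sequences on the integers *)

Section strong_log_concavity.
Context {R : realType}.
Implicit Types p q r : int -> R.

(** For a nonnegative sequence this merges log-concavity and connectedness of the support into one
    condition, the one that passes to convolutions. *)
Definition strongly_log_concave p := forall a b c d : int,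
  a <= b -> a <= c -> a + d = b + c -> p a * p d <= p b * p c.

(** [step1] moves both outer indices inward by one place, by induction on their distance; [step2]
    iterates this [j] times. *)
Lemma strongly_log_concaveP p : (forall k, 0 <= p k) ->
  (forall k, p (k - 1) * p (k + 1) <= p k ^+ 2) ->
  (forall i j k : int, i <= j -> j <= k -> 0 < p i -> 0 < p k -> 0 < p j) ->
  strongly_log_concave p.
Proof.
move=> p0 plc psupp.
have step1 (k : nat) (a : int) : p a * p (a + k%:Z + 1) <= p (a + 1) * p (a + k%:Z).
  elim: k => [|k IH]; first by rewrite addr0 mulrC.
  have -> : a + k.+1%:Z = a + k%:Z + 1 by lia.
  have := plc (a + k%:Z + 1); rewrite addrK => H.
  have := p0 (a + k%:Z); rewrite le_eqVlt => /predU1P[pk0|pk].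
    (* Division by p(a + k) is impossible here, but a zero between a and a + k + 2 forces one of the
       outer values to vanish, the support being connected. *)
    suff -> : p a * p (a + k%:Z + 1 + 1) = 0 by rewrite mulr_ge0.
    apply/eqP; rewrite mulf_eq0; apply/negPn/negP; rewrite negb_or => /andP[n1 n2].
    have := @psupp a (a + k%:Z) (a + k%:Z + 1 + 1).
    by rewrite !lt0r !p0 n1 n2 -pk0 eqxx/= => /(_ ltac:(lia) ltac:(lia) isT isT).
  rewrite -(ler_pM2r pk).
  apply: (@le_trans _ _ (p a * p (a + k%:Z + 1) ^+ 2)).
    by rewrite -mulrA ler_wpM2l// mulrC.
  by rewrite expr2 mulrA; apply: le_trans (ler_wpM2r (p0 _) IH) _; rewrite mulrAC.
have step2 (j k : nat) (a : int) :
    p a * p (a + j%:Z + j%:Z + k%:Z) <= p (a + j%:Z) * p (a + j%:Z + k%:Z).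
  elim: j a => [|j IH] a; first by rewrite !addr0.
  have := step1 (j + j + k).+1 a.
  have -> : a + (j + j + k).+1%:Z + 1 = a + j.+1%:Z + j.+1%:Z + k%:Z by lia.
  move/le_trans; apply; have := IH (a + 1).
  have -> : a + 1 + j%:Z + j%:Z + k%:Z = a + (j + j + k).+1%:Z by lia.
  by have -> : a + 1 + j%:Z = a + j.+1%:Z by lia.
move=> a b c d; wlog bc : b c / b <= c => [H ab ac E|ab ac E].
  have [bc|/ltW cb] := leP b c; first exact: H.
  by rewrite [leRHS]mulrC; apply: (H c b) => //; rewrite E addrC.
have := step2 `|b - a|%N `|c - b|%N a.
have -> : a + `|b - a|%N%:Z + `|b - a|%N%:Z + `|c - b|%N%:Z = d by lia.
have -> : a + `|b - a|%N%:Z + `|c - b|%N%:Z = c by lia.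
by have -> : a + `|b - a|%N%:Z = b by lia.
Qed.

(* Both products are sums over pairs (i, j).  The substitution
   (i, j) -> (j - e, i + e), with e = c - a, exchanges the roles of (a, d) and
   (b, c), so twice the inequality is a sum of X Y' + X' Y <= X Y + X' Y',
   where X - X' and Y - Y' have the same sign. *)
Lemma convolution_slc p q r : (forall k, 0 <= p k) -> (forall k, 0 <= q k) ->
  (forall k, \esum_(i in [set: int]) (q i * p (k - i))%:E = (r k)%:E) ->
  strongly_log_concave p -> strongly_log_concave q -> strongly_log_concave r.
Proof.
move=> p0 q0 rE pc qc a b c d ab ac E.
have [e eE] : exists e : int, c = a + e by exists (c - a); rewrite addrC subrK.
pose X (z : int * int) := q z.1 * q z.2.
pose Y (z : int * int) := p (b - z.1) * p (c - z.2).
pose X' (z : int * int) := q (z.2 - e) * q (z.1 + e).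
pose Y' (z : int * int) := p (a - z.1) * p (d - z.2).
have X0 z : 0 <= X z by rewrite mulr_ge0.
have Y0 z : 0 <= Y z by rewrite mulr_ge0.
have X'0 z : 0 <= X' z by rewrite mulr_ge0.
have Y'0 z : 0 <= Y' z by rewrite mulr_ge0.
have invol : set_bij [set: int * int] [set: int * int] (fun z => (z.2 - e, z.1 + e)).
  split => //; first by move=> [i j] [i' j'] _ _ /= [/addIr -> /addIr ->].
  by move=> [i j] _; exists (j - e, i + e) => //=; rewrite subrK addrK.
have XYE : (\esum_(z in [set: int * int]) (X z * Y z)%:E = (r b * r c)%:E)%E.
  rewrite -(esumM _ _ (rE b) (rE c)); try by move=> *; rewrite mulr_ge0.
  by apply: eq_esum => z _; rewrite /X /Y mulrACA.
have XY'E : (\esum_(z in [set: int * int]) (X z * Y' z)%:E = (r a * r d)%:E)%E.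
  rewrite -(esumM _ _ (rE a) (rE d)); try by move=> *; rewrite mulr_ge0.
  by apply: eq_esum => z _; rewrite /X /Y' mulrACA.
have X'Y'E : (\esum_(z in [set: int * int]) (X' z * Y' z)%:E = (r b * r c)%:E)%E.
  rewrite -XYE [RHS](reindex_esum _ _ _ _ invol); apply: eq_esum => -[i j] _.
  rewrite /X /Y /X' /Y'/= [p (a - i) * _]mulrC.
  by congr (_ * (p _ * p _))%:E; lia.
have X'YE : (\esum_(z in [set: int * int]) (X' z * Y z)%:E = (r a * r d)%:E)%E.
  rewrite -XY'E [RHS](reindex_esum _ _ _ _ invol); apply: eq_esum => -[i j] _.
  rewrite /X /Y /X' /Y'/= [p (b - i) * _]mulrC.
  by congr (_ * (p _ * p _))%:E; lia.
suff : ((r a * r d)%:E + (r a * r d)%:E <= (r b * r c)%:E + (r b * r c)%:E)%E.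
  by rewrite -!EFinD lee_fin; lra.
rewrite -{1}XY'E -X'YE -{1}XYE -X'Y'E -!esumD; try by move=> *; rewrite lee_fin mulr_ge0.
apply: le_esum => -[i j] _; rewrite -!EFinD lee_fin.
have [le|/ltW le] := leP (j - e) i.
  have XX : X' (i, j) <= X (i, j) by apply: qc; rewrite /=; lia.
  have YY : Y' (i, j) <= Y (i, j) by apply: pc; rewrite /=; lia.
  nra.
have XX : X (i, j) <= X' (i, j) by apply: qc; rewrite /=; lia.
have YY : Y (i, j) <= Y' (i, j).
  by rewrite /Y [leLHS]mulrC; apply: pc; rewrite /=; lia.
nra.
Qed.
End strong_log_concavity.

(** * Tails of log-concave sequences *)

Section log_concave_tails.
Context {R : realType}.

(* Split off the first N terms and shift the others by N: with A_j the sum of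
   k^j a_k, this yields A_1 <= N V + (A_1 + N V) / 2, and similarly for A_2. *)
Lemma halving_second_moment (a : nat -> R) (N : nat) (V : R) :
  (forall k, 0 <= a k) -> (forall k, a (N + k)%N <= a k / 2) ->
  (forall K, \sum_(k < K) a k <= V) ->
  forall K, \sum_(k < K) k%:R ^+ 2 * a k <= 9 * N%:R ^+ 2 * V.
Proof.
move=> a0 aN aV K.
have split (w : nat -> R) : (forall k, 0 <= w k) -> {homo w : i j / (i <= j)%N >-> i <= j} ->
    \sum_(k < K) w k * a k <= w N * V + \sum_(k < K) w (N + k)%N * (a k / 2).
  move=> w0 wm; apply: (@le_trans _ _ (\sum_(k < N + K) w k * a k)).
    rewrite -!(big_mkord xpredT (fun k => w k * a k)).
    rewrite [leRHS](big_cat_nat (n := K)) ?leq_addl//= lerDl.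
    by apply: sumr_ge0 => i _; rewrite mulr_ge0.
  rewrite big_split_ord/=; apply: lerD.
    apply: (@le_trans _ _ (\sum_(k < N) w N * a k)).
      by apply: ler_sum => i _; rewrite ler_wpM2r// wm// ltnW.
    by rewrite -mulr_sumr ler_wpM2l.
  by apply: ler_sum => i _; rewrite ler_wpM2l.
have mono1 : {homo (fun k : nat => k%:R : R) : i j / (i <= j)%N >-> i <= j}.
  by move=> i j; rewrite ler_nat.
have mono2 : {homo (fun k : nat => k%:R ^+ 2 : R) : i j / (i <= j)%N >-> i <= j}.
  by move=> i j; rewrite ler_sqr ?nnegrE// ler_nat.
have V1 : \sum_(k < K) k%:R * a k <= 3 * N%:R * V.
  have := split (fun k => k%:R) (fun k => ler0n _ k) mono1.
  have -> : \sum_(k < K) (N + k)%:R * (a k / 2) =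
      (\sum_(k < K) k%:R * a k) / 2 + N%:R / 2 * \sum_(k < K) a k.
    rewrite mulr_suml mulr_sumr -big_split/=; apply: eq_bigr => i _.
    by rewrite natrD; field.
  have : N%:R / 2 * \sum_(k < K) a k <= N%:R / 2 * V by rewrite ler_wpM2l// divr_ge0.
  lra.
have := split (fun k => k%:R ^+ 2) (fun k => exprn_ge0 _ (ler0n _ k)) mono2.
have -> : \sum_(k < K) (N + k)%:R ^+ 2 * (a k / 2) =
    (\sum_(k < K) k%:R ^+ 2 * a k) / 2 + N%:R * (\sum_(k < K) k%:R * a k)
    + N%:R ^+ 2 / 2 * \sum_(k < K) a k.
  rewrite mulr_suml !mulr_sumr -!big_split/=; apply: eq_bigr => i _.
  by rewrite natrD; field.
have : N%:R ^+ 2 / 2 * \sum_(k < K) a k <= N%:R ^+ 2 / 2 * V.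
  by rewrite ler_wpM2l// divr_ge0// exprn_ge0.
have : N%:R * (\sum_(k < K) k%:R * a k) <= N%:R * (3 * N%:R * V) by rewrite ler_wpM2l.
lra.
Qed.

(** Let M = a(0) and let N be the integer part of 2 / M. If a(N) exceeded M / 2, the first N + 1
    terms would sum to more than 1. So a(N) <= M / 2, log-concavity gives a(N + k) <= a(k) / 2, and
    9 N^2 <= 36 / M^2. *)
Lemma one_sided_second_moment (a : nat -> R) :
  (forall k, 0 <= a k) -> 0 < a 0%N -> {homo a : i j / (i <= j)%N >-> j <= i} ->
  (forall k l, a 0%N * a (k + l)%N <= a k * a l) ->
  (forall K, \sum_(k < K) a k <= 1) ->
  forall K, \sum_(k < K) k%:R ^+ 2 * a k <= 36 / a 0%N ^+ 2.
Proof.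
move=> a0 M0 am alc a1 K; set M := a 0%N in M0 alc *.
pose N := Num.truncn (2 / M).
have /andP[N1 N2] : N%:R <= 2 / M < N.+1%:R by rewrite truncn_itv// divr_ge0// ltW.
have aN : a N <= M / 2.
  rewrite leNgt; apply/negP => MN; have := a1 N.+1; rewrite leNgt => /negP; apply.
  apply: (@lt_le_trans _ _ (\sum_(k < N.+1) M / 2)).
    rewrite sumr_const card_ord -mulr_natr; move: N2.
    by rewrite ltr_pdivrMr//; nra.
  apply: ler_sum => i _; rewrite (le_trans (ltW MN))// am//; exact: leq_ord.
apply: le_trans (@halving_second_moment a N 1 a0 _ a1 K) _.
  move=> k; rewrite -(ler_pM2l M0) (le_trans (alc N k))//.
  by rewrite [leRHS]mulrC -mulrA [_^-1 * M]mulrC [leRHS]mulrC ler_wpM2r.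
rewrite mulr1 (_ : 36 / M ^+ 2 = 9 * (2 / M) ^+ 2); last by field; rewrite gt_eqF.
by rewrite ler_wpM2l// ler_sqr// nnegrE ?divr_ge0// ltW.
Qed.

Variable p : int -> R.
Hypothesis p0 : forall k, 0 <= p k.
Hypothesis p1 : (\esum_(k in [set: int]) (p k)%:E = 1)%E.

(** Below some positive value p(k0) nothing competes for the maximum, and only finitely many indices
    reach p(k0), since the total mass is 1. *)
Lemma pmf_mode : exists m, 0 < p m /\ forall k, p k <= p m.
Proof.
have [k0 pk0] : exists k, 0 < p k.
  apply/not_existsP => H; have : (\esum_(k in [set: int]) (p k)%:E = 0)%E.
    rewrite esum1// => k _; congr EFin; apply/eqP; rewrite eq_le p0 andbT leNgt.
    exact/negP/H.
  by rewrite p1 => /eqP; rewrite eqe oner_eq0.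
pose A := [set k | p k0 <= p k].
have fA : finite_set A.
  apply: contrapT => /(infinite_set_fset (Num.truncn (1 / p k0)).+1) [B BA nB].
  have : ((\sum_(k <- B) p k)%:E <= 1 :> \bar R)%E.
    rewrite -p1 -sumEFin; apply: esum_ge; exists [set` B] => //.
    by rewrite fsbig_finite//= set_fsetK.
  rewrite lee_fin leNgt => /negP; apply.
  apply: (@lt_le_trans _ _ (\sum_(k <- B) p k0)).
    rewrite big_const_seq count_predT iter_addr_0 -mulr_natr.
    rewrite -ltr_pdivrMl// mulrC; apply: (@lt_le_trans _ _ (Num.truncn (1 / p k0)).+1%:R).
      by rewrite truncnS_gt.
    by rewrite ler_nat.
  by rewrite big_seq [leRHS]big_seq; apply: ler_sum => k kB; apply: BA.
have k0A : k0 \in fset_set A by rewrite in_fset_set// inE /A/=.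
have [m _ mmax] := @Order.TotalTheory.arg_maxP _ _ _ [` k0A]%fset xpredT (fun i => p (val i)) isT.
have mA : p k0 <= p (val m) by exact: (mmax [` k0A]%fset isT).
exists (val m); split=> [|k]; first exact: lt_le_trans mA.
have [kA|/ltW kA] := leP (p k0) (p k); last exact: le_trans mA.
have kA' : k \in fset_set A by rewrite in_fset_set// inE.
exact: (mmax [` kA']%fset isT).
Qed.

Hypothesis plc : strongly_log_concave p.
Variable m : int.
Hypothesis pm0 : 0 < p m.
Hypothesis pm : forall k, p k <= p m.

(** Strong log-concavity with outer pair (m, k) and inner pair (j, m + k - j); the extra factor is
    at most p(m), which then cancels. *)
Lemma nonincreasing_right_mode j k : m <= j -> j <= k -> p k <= p j.
Proof.
move=> mj jk; rewrite -(ler_pM2l pm0).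
apply: (@le_trans _ _ (p j * p (m + k - j))); first by apply: plc => //; lia.
by rewrite [leRHS]mulrC ler_wpM2l.
Qed.

Lemma nondecreasing_left_mode j k : k <= j -> j <= m -> p k <= p j.
Proof.
move=> kj jm; rewrite -(ler_pM2r pm0).
apply: (@le_trans _ _ (p j * p (k + m - j))); first by apply: plc => //; lia.
by rewrite ler_wpM2l.
Qed.

(** Each side of the mode is a nonincreasing sequence starting at p(m) and contributes 36 /
    p(m)^2. *)
Lemma second_moment_le :
  (\esum_(k in [set: int]) ((k - m)%:~R ^+ 2 * p k)%:E <= (72 / p m ^+ 2)%:E)%E.
Proof.
rewrite -(esum_shift m); under eq_esum do rewrite addrK.
rewrite esum_int_split => [|k]; last by rewrite lee_fin mulr_ge0// sqr_ge0.
have sum1 (g : nat -> int) : injective g -> forall K, \sum_(i < K) p (g i) <= 1.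
  move=> gI K; rewrite -lee_fin -p1 -sumEFin.
  exact: (esum_int_sum_nat (fun k => (p k)%:E)).
have right K : \sum_(k < K) k%:R ^+ 2 * p (k%:Z + m) <= 36 / p m ^+ 2.
  have E0 : p m = (fun k : nat => p (k%:Z + m)) 0%N by rewrite add0r.
  rewrite E0; apply: (one_sided_second_moment (a := fun k : nat => p (k%:Z + m))) => //; rewrite -?E0//.
  - by move=> i j ij; apply: nonincreasing_right_mode; lia.
  - by move=> k l; apply: plc; lia.
  - by apply: (sum1 (fun k : nat => k%:Z + m)) => i j; lia.
have left K : \sum_(k < K) k%:R ^+ 2 * p (- k%:Z + m) <= 36 / p m ^+ 2.
  have E0 : p m = (fun k : nat => p (- k%:Z + m)) 0%N by rewrite oppr0 add0r.
  rewrite E0; apply: (one_sided_second_moment (a := fun k : nat => p (- k%:Z + m))) => //; rewrite -?E0//.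
  - by move=> i j ij; apply: nondecreasing_left_mode; lia.
  - by move=> k l; rewrite mulrC; apply: plc; lia.
  - by apply: (sum1 (fun k : nat => - k%:Z + m)) => i j; lia.
rewrite (_ : 72 / p m ^+ 2 = 36 / p m ^+ 2 + 36 / p m ^+ 2) ?EFinD; last by lra.
apply: leeD; apply: lime_le; try (apply: is_cvg_nneseries => *; rewrite lee_fin mulr_ge0// sqr_ge0//).
  by apply: nearW => K; rewrite big_mkord sumEFin lee_fin; exact: right.
(* The left series starts at -1, so its first K terms are the first K + 1 terms of [left], whose
   term at 0 vanishes. *)
apply: nearW => K; rewrite big_mkord sumEFin lee_fin; apply: le_trans (left K.+1).
rewrite big_ord_recl/= mulr0n expr0n/= mul0r add0r; apply: ler_sum => i _.
by rewrite /bump/= add1n rmorphN/= sqrrN.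
Qed.

End log_concave_tails.

(** * The function - x ln x *)

Section entropy_function.
Context {R : realType}.
Implicit Types x y t : R.

Definition eta x : R := - (x * ln x).

Let ln_le_subr1 x : 0 < x -> ln x <= x - 1.
Proof.
by move=> x0; rewrite -{1}(subrKC 1 x); apply: le_ln1Dx; lra.
Qed.

Lemma eta0 : eta 0 = 0. Proof. by rewrite /eta mul0r oppr0. Qed.

Lemma eta_ge0 x : 0 <= x <= 1 -> 0 <= eta x.
Proof. by move=> /andP[x0 x1]; rewrite /eta -mulrN mulr_ge0// oppr_ge0 ln_le0. Qed.

(** Since ln y <= -1, - (y - x) ln y >= y - x, while x ln(y / x) <= y - x; the difference eta(y) -
    eta(x) is the first quantity minus the second. *)
Lemma eta_le x y : 0 <= x -> x <= y -> y <= expR (- 1) -> eta x <= eta y.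
Proof.
rewrite le_eqVlt => /predU1P[<- y0 y1|x0 xy y1].
  rewrite eta0 eta_ge0// y0 (le_trans y1)// -expR0 ler_expR; lra.
have y0 : 0 < y by exact: lt_le_trans xy.
have lny : ln y <= -1 by rewrite -(expRK (-1)) ler_ln// posrE expR_gt0.
have yx0 : 0 < y / x by rewrite divr_gt0.
have H : x * ln (y / x) <= y - x.
  rewrite -ler_pdivlMl// mulrBr mulVf ?gt_eqF// [_^-1 * y]mulrC.
  exact: ln_le_subr1.
move: H; rewrite ln_div ?posrE// /eta mulrBr; nra.
Qed.

(** An affine majorant of slope t, from ln z <= z - 1 at z = exp(-t) / x. Taking t quadratic in the
    index bounds an entropy by a second moment plus a convergent sum. *)
Lemma eta_le_affine x t : 0 <= x -> eta x <= x * t + expR (- t).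
Proof.
rewrite le_eqVlt => /predU1P[<-|x0]; first by rewrite eta0 mul0r add0r expR_ge0.
have H : ln (expR (- t) / x) <= expR (- t) / x - 1.
  by apply: ln_le_subr1; rewrite divr_gt0// expR_gt0.
have : x * ln (expR (- t) / x) <= expR (- t) - x.
  by apply: le_trans (ler_wpM2l (ltW x0) H) _; rewrite mulrBr mulrCA mulfV ?gt_eqF// !mulr1.
rewrite ln_div ?posrE// ?expR_gt0// expRK /eta; nra.
Qed.

(** A quantitative form of eta(x) -> 0 at 0, for the o(1) claim; it is ln z <= z - 1 at z = 1 / sqrt
    x. *)
Lemma eta_le_sqrt x : 0 <= x -> eta x <= 2 * Num.sqrt x.
Proof.
rewrite le_eqVlt => /predU1P[<-|x0]; first by rewrite eta0 mulr_ge0.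
set s := Num.sqrt x; have s0 : 0 < s by rewrite sqrtr_gt0.
have -> : x = s ^+ 2 by rewrite sqr_sqrtr// ltW.
have H : ln s^-1 <= s^-1 - 1.
  by apply: ln_le_subr1; rewrite invr_gt0.
rewrite /eta expr2 lnM ?posrE//; move: H; rewrite lnV ?posrE// => H.
have : s * s * - ln s <= s * s * (s^-1 - 1) by rewrite ler_wpM2l// mulr_ge0// ltW.
have -> : s * s * (s^-1 - 1) = s - s * s by field; rewrite gt_eqF.
by nra.
Qed.

Lemma measurable_eta : measurable_fun [set: R] eta.
Proof.
by apply: measurableT_comp => //; apply: measurable_funM => //; exact: measurable_ln.
Qed.
End entropy_function.

(** * Countable partitions into fibers of an integer-valued map *)

Section fibers.
Context {d : measure_display} {T : measurableType d} {R : realType}.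
Variables (mu : {measure set T -> \bar R}) (phi : T -> int).
Hypothesis mphi : forall k, measurable (phi @^-1` [set k]).

Let fibers := fun i => phi @^-1` [set int_of_nat i].

Let trivIset_fibers : trivIset [set: nat] fibers.
Proof.
apply/trivIsetP => i j _ _ ij; rewrite -subset0 => t [/= ti tj]; move/eqP: ij; apply.
by have [_ + _] := int_of_nat_bij; apply; rewrite ?inE// -ti -tj.
Qed.

Let bigcup_fibers : \bigcup_i fibers i = setT.
Proof.
apply/seteqP; split=> // t _.
by have [_ _ /(_ (phi t) I)[i _ E]] := int_of_nat_bij; exists i.
Qed.

Lemma measurable_fiber (d' : measure_display) (T' : measurableType d') (G : int -> T') :
  measurable_fun [set: T] (G \o phi).
Proof.
move=> _ B mB; rewrite setTI.
rewrite (_ : _ @^-1` B = \bigcup_i (fibers i `&` [set _ | B (G (int_of_nat i))])).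
  apply: bigcupT_measurable => i; apply: measurableI; first exact: mphi.
  have [BG|BG] := pselect (B (G (int_of_nat i))).
    by rewrite (_ : [set _ | _] = setT)//; apply/seteqP; split.
  by rewrite (_ : [set _ | _] = set0)//; apply/seteqP; split.
apply/seteqP; split=> [t BGt|t [i _ [/= <-]]//].
have : (\bigcup_i fibers i) t by rewrite bigcup_fibers.
by move=> [i _ Fi]; exists i => //; split => //=; rewrite -Fi.
Qed.

Lemma ge0_integral_fiber (G : int -> \bar R) : (forall k, 0 <= G k)%E ->
  (\int[mu]_t G (phi t) = \esum_(k in [set: int]) (G k * mu (phi @^-1` [set k])))%E.
Proof.
move=> G0; rewrite esum_int_nneseries => [|k]; last by rewrite mule_ge0.
rewrite -bigcup_fibers ge0_integral_bigcup//; last 2 first.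
- by move=> i; exact: mphi.
- by rewrite bigcup_fibers; exact: (measurable_fiber G).
apply: eq_eseriesr => i _.
rewrite (eq_integral (cst (G (int_of_nat i)))); last first.
  by move=> t; rewrite inE /fibers/= => ->.
by rewrite integral_cst//; exact: mphi.
Qed.

Lemma measure_fiber (E : set T) : measurable E ->
  (mu E = \esum_(k in [set: int]) mu (E `&` phi @^-1` [set k]))%E.
Proof.
move=> mE; rewrite esum_int_nneseries//.
rewrite -{1}[E]setIT -bigcup_fibers setI_bigcupr measure_bigcup//.
- by apply: eq_eseriesl => i; rewrite in_setT.
- by move=> i _; apply: measurableI => //; exact: mphi.
- by apply: trivIset_setIl; exact: trivIset_fibers.
Qed.
End fibers.

(** * Sums over the integers as Lebesgue integrals *)

Section floor_integral.
Context {R : realType}.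

Lemma preimage_floor (k : int) :
  (Num.floor : R -> int) @^-1` [set k] = `[k%:~R, (k + 1)%:~R[%classic.
Proof.
apply/seteqP; split => x /=; rewrite in_itv/=.
  by move=> <-; exact: floor_itv.
exact: floor_def.
Qed.

Lemma measurable_preimage_floor (k : int) :
  measurable ((Num.floor : R -> int) @^-1` [set k]).
Proof. by rewrite preimage_floor. Qed.

(** The fibers of [Num.floor] are half-open intervals of length 1. This puts Shannon and
    differential entropy on the same footing. *)
Lemma ge0_integral_floor (G : int -> \bar R) : (forall k, 0 <= G k)%E ->
  (\int[@lebesgue_measure R]_x G (Num.floor x) = \esum_(k in [set: int]) G k)%E.
Proof.
move=> G0; have := ge0_integral_fiber (@lebesgue_measure R) measurable_preimage_floor G0.
move=> ->.
apply: eq_esum => k _; rewrite preimage_floor.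
have := @lebesgue_measure_itv R `[k%:~R, (k + 1)%:~R[.
rewrite /= lte_fin ltr_int ifT; last by rewrite ltzD1.
by rewrite -EFinB -rmorphB/= [_ + 1]addrC addrK => E; rewrite [X in (_ * X)%E]E mule1.
Qed.
End floor_integral.

(** * Window maxima and minima of a unimodal sequence *)

Section windows.
Context {R : realType} (p : int -> R) (m : int) (s : nat).
Hypothesis p0 : forall k, 0 <= p k.
Hypothesis p1 : (\esum_(k in [set: int]) (p k)%:E = 1)%E.
Hypothesis plc : strongly_log_concave p.
Hypothesis pm0 : 0 < p m.
Hypothesis pm : forall k, p k <= p m.
Hypothesis pme : p m <= expR (- 1).
Let q k := eta (p k).
Let H := (\esum_(k in [set: int]) (q k)%:E)%E.

Let pm1 : p m <= 1.
Proof. by rewrite (le_trans pme)// -expR0 ler_expR; lra. Qed.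

Let q0 k : 0 <= q k.
Proof. by rewrite eta_ge0// p0/= (le_trans (pm k)). Qed.

Let q_le k l : p k <= p l -> q k <= q l.
Proof. by move=> kl; apply: eta_le => //; exact: le_trans (pm l) _. Qed.

(** [eta_le_affine] with t = (k - m)^2 splits the sum into the second moment about the mode and a
    Gaussian sum dominated by a geometric one. *)
Lemma entropy_sum_fin : (H < +oo)%E.
Proof.
pose g (k : int) : R := expR (- (k - m)%:~R ^+ 2).
apply: (@le_lt_trans _ _ (\esum_(k in [set: int]) (((k - m)%:~R ^+ 2 * p k)%:E + (g k)%:E))%E).
  apply: le_esum => k _; rewrite -EFinD lee_fin mulrC.
  exact: eta_le_affine.
rewrite esumD; try by move=> k _; rewrite lee_fin ?expR_ge0// mulr_ge0// sqr_ge0.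
apply: lte_add_pinfty.
  by apply: le_lt_trans (second_moment_le p0 p1 plc pm0 pm) _; rewrite ltry.
rewrite -(esum_shift m); under eq_esum do rewrite /g addrK.
rewrite esum_int_split; last by move=> k; rewrite lee_fin expR_ge0.
have geo K : \sum_(i < K) expR (- (i%:R : R)) <= 2.
  (* Strengthened for the induction: the reserve 2 exp(-K) pays for the next term because exp(-1) <=
     1/2. *)
  suff : \sum_(i < K) expR (- (i%:R : R)) <= 2 - 2 * expR (- K%:R).
    by have := expR_ge0 (- K%:R : R); lra.
  elim: K => [|K IH]; first by rewrite big_ord0 oppr0 expR0; lra.
  rewrite big_ord_recr/= -[X in - X%:R]addn1 natrD opprD expRD.
  have : expR (-1) <= 2^-1 :> R.
    by rewrite expRN lef_pV2 ?posrE ?expR_gt0//; have := @expR_ge1Dx R 1; lra.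
  have := expR_gt0 (- K%:R : R); nra.
have sq (i : nat) : expR (- i%:R ^+ 2) <= expR (- i%:R) :> R.
  by rewrite ler_expR lerN2 -natrX ler_nat; nia.
apply: lte_add_pinfty; apply: (@le_lt_trans _ _ 2%:E); rewrite ?ltry//;
  apply: lime_le; try (apply: is_cvg_nneseries => *; rewrite lee_fin expR_ge0//);
  apply: nearW => K; rewrite big_mkord sumEFin lee_fin.
  by apply: le_trans (geo K); apply: ler_sum => i _; exact: sq.
apply: le_trans (geo K.+1); rewrite big_ord_recl oppr0 expR0.
apply: ler_wpDl => //; apply: ler_sum => i _.
by rewrite /= rmorphN/= sqrrN; exact: sq.
Qed.

(* A + D dominates the maximum of q over the window {k - s, ..., k}, and B - D is
   dominated by its minimum; A and B have the same sum as q. *)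
Let A (k : int) : R :=
  (if k <= m then q k else 0) + (if m < k - s%:Z then q (k - s%:Z) else 0).
Let B (k : int) : R :=
  (if m < k then q k else 0) + (if k - s%:Z <= m then q (k - s%:Z) else 0).
Let D (k : int) : R := if m < k <= m + s%:Z then q m else 0.

(** Says that [x] lies between the minimum and the maximum of [p] over {k - s, ..., k}, through
    arbitrary bounds [c] so that no extremum has to be formed. *)
Definition windowed (x : R) (k : int) :=
  (forall c, (forall j, (j <= s)%N -> p (k - j%:Z) <= c) -> x <= c) /\
  (forall c, (forall j, (j <= s)%N -> c <= p (k - j%:Z)) -> c <= x).

Let A0 k : 0 <= A k. Proof. by rewrite addr_ge0//; case: ifP. Qed.
Let B0 k : 0 <= B k. Proof. by rewrite addr_ge0//; case: ifP. Qed.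
Let D0 k : 0 <= D k. Proof. by rewrite /D; case: ifP. Qed.

(** Shifted by [s], the second summand of [A] is [q] above the mode, which complements the first
    summand. *)
Let sum_A : (\esum_(k in [set: int]) (A k)%:E = H)%E.
Proof.
under eq_esum do rewrite EFinD.
rewrite esumD; try by move=> k _; rewrite lee_fin; case: ifP.
rewrite (esum_shift (- s%:Z) (fun k => (if m < k then q k else 0)%:E)).
rewrite -esumD; try by move=> k _; rewrite lee_fin; case: ifP.
by apply: eq_esum => k _; case: ltP => _; rewrite ?adde0 ?add0e.
Qed.

Let sum_B : (\esum_(k in [set: int]) (B k)%:E = H)%E.
Proof.
under eq_esum do rewrite EFinD.
rewrite esumD; try by move=> k _; rewrite lee_fin; case: ifP.
rewrite (esum_shift (- s%:Z) (fun k => (if k <= m then q k else 0)%:E)).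
rewrite -esumD; try by move=> k _; rewrite lee_fin; case: ifP.
by apply: eq_esum => k _; case: leP => _; rewrite ?adde0 ?add0e.
Qed.

Let sum_D : (\esum_(k in [set: int]) (D k)%:E = (s%:R * q m)%:E)%E.
Proof.
pose W := [set m + 1 + i%:Z | i in `I_s].
transitivity (\esum_(k in W) (q m)%:E)%E.
  have WE (k : int) : (k \in W) = (m < k <= m + s%:Z).
    apply/idP/idP; first by rewrite inE => -[i /= si <-]; lia.
    move=> mk; rewrite inE; exists (absz (k - m - 1)%R) => /=; lia.
  by rewrite [RHS]esum_mkcond; apply: eq_esum => k _; rewrite /D WE; case: ifP.
rewrite esum_image; last by move=> i j _ _; lia.
rewrite esum_fset//; last by move=> *; rewrite lee_fin.
rewrite -(fsbig_ord _ s (fun=> (q m)%:E)) sumEFin; congr EFin.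
by rewrite sumr_const card_ord mulr_natl.
Qed.

(** The maximum of [p] over the window is at k on the rising side and at k - s on the falling side;
    when the window straddles the mode, [D] supplies q(m). *)
Let eta_windowed_le x k : 0 <= x -> windowed x k -> eta x <= A k + D k.
Proof.
move=> x0 [hi _]; rewrite /A /D.
have etaP l : (forall j, (j <= s)%N -> p (k - j%:Z) <= p l) -> eta x <= q l.
  by move=> /hi xl; apply: eta_le => //; exact: le_trans (pm l) _.
have [km|mk] := leP k m.
  apply: (@le_trans _ _ (q k)).
    by apply: etaP => j js; apply: (nondecreasing_left_mode p0 plc pm0 pm); lia.
  by rewrite -addrA lerDl addr_ge0//; case: ifP.
have [mks|ksm] := ltP m (k - s%:Z).
  rewrite add0r; apply: (@le_trans _ _ (q (k - s%:Z))).
    by apply: etaP => j js; apply: (nonincreasing_right_mode p0 plc pm0 pm); lia.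
  by rewrite lerDl; case: ifP.
by rewrite ifT ?add0r; [exact: etaP|lia].
Qed.

(** The minimum over the window is at one of its ends. When the window straddles the mode, [B]
    counts both ends: the smaller is below eta(x), and [D] pays for the larger. *)
Let le_eta_windowed x k : 0 <= x -> windowed x k -> B k <= eta x + D k.
Proof.
move=> x0 [hi lo]; rewrite /B /D.
have xe : x <= expR (- 1) by apply: le_trans pme; apply: hi.
have etaP l : (forall j, (j <= s)%N -> p l <= p (k - j%:Z)) -> q l <= eta x.
  by move=> /lo xl; exact: eta_le.
have [mk|km] := ltP m k; last first.
  rewrite ifT; last by lia.
  rewrite andFb addr0 add0r; apply: etaP => j js.
  by apply: (nondecreasing_left_mode p0 plc pm0 pm); lia.
have [ksm|mks] := leP (k - s%:Z) m; last first.
  rewrite addr0 -[leLHS]addr0; apply: lerD; last by case: ifP.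
  by apply: etaP => j js; apply: (nonincreasing_right_mode p0 plc pm0 pm); lia.
rewrite ifT; last by lia.
have [kks|ksk] := leP (p k) (p (k - s%:Z)).
  apply: lerD; last exact: q_le.
  apply: etaP => j js; have [jm|mj] := leP m (k - j%:Z).
    by apply: (nonincreasing_right_mode p0 plc pm0 pm); lia.
  apply: le_trans kks _; apply: (nondecreasing_left_mode p0 plc pm0 pm); lia.
rewrite addrC; apply: lerD; last exact: q_le.
apply: etaP => j js; have [jm|mj] := leP (k - j%:Z) m.
  by apply: (nondecreasing_left_mode p0 plc pm0 pm); lia.
apply: le_trans (ltW ksk) _; apply: (nonincreasing_right_mode p0 plc pm0 pm); lia.
Qed.

Lemma windowed_entropy_le (f : R -> R) : measurable_fun [set: R] f ->
  (forall x, 0 <= f x) -> (forall x, windowed (f x) (Num.floor x)) ->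
  (`|\int[lebesgue_measure]_x (eta (f x))%:E - H| <= (s%:R * q m)%:E)%E.
Proof.
move=> mf f0 fw; set h := (\int[_]_x _)%E.
have eta0f x : 0 <= eta (f x).
  rewrite eta_ge0// f0/=; apply: le_trans pm1; apply: (fw x).1 => j _; exact: pm.
have meta : measurable_fun [set: R] (fun x => (eta (f x))%:E).
  by apply/measurable_EFinP; exact: measurableT_comp measurable_eta mf.
have mG (G : int -> R) : measurable_fun [set: R] (fun x : R => (G (Num.floor x))%:E).
  exact: (measurable_fiber measurable_preimage_floor (EFin \o G)).
have upper : (h <= H + (s%:R * q m)%:E)%E.
  rewrite -sum_A -sum_D -!ge0_integral_floor -?ge0_integralD//;
    try (by move=> *; rewrite lee_fin); try exact: mG.
  apply: ge0_le_integral => //.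
  - by move=> x _; rewrite lee_fin.
  - by apply: emeasurable_funD; exact: mG.
  - by move=> x _; rewrite -EFinD lee_fin; exact: eta_windowed_le.
have lower : (H <= h + (s%:R * q m)%:E)%E.
  rewrite -sum_B -sum_D -!ge0_integral_floor -?ge0_integralD//;
    try (by move=> *; rewrite lee_fin); try exact: mG.
  apply: ge0_le_integral => //.
  - by move=> x _; rewrite lee_fin.
  - exact: mG.
  - by apply: emeasurable_funD => //; exact: mG.
  - by move=> x _; rewrite -EFinD lee_fin; exact: le_eta_windowed.
(* Finiteness of [H], and then of [h] by the upper bound, lets the two one-sided bounds be combined
   in the reals. *)
have Hfin : H \is a fin_num.
  rewrite ge0_fin_numE; first exact: entropy_sum_fin.
  by apply: esum_ge0 => k _; exact: q0.
have hfin : h \is a fin_num.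
  rewrite ge0_fin_numE; last by apply: integral_ge0 => x _; exact: eta0f.
  by apply: le_lt_trans upper _; apply: lte_add_pinfty; [exact: entropy_sum_fin|exact: ltry].
move: upper lower; rewrite -(fineK Hfin) -(fineK hfin) -!EFinD !lee_fin => u l.
by rewrite ler_norml; apply/andP; split; lra.
Qed.
End windows.

(** * Integer-valued random variables *)

Section random_variables.
Context {d : measure_display} {T : measurableType d} {R : realType}
  (P : probability T R).
Implicit Types X Y : {RV P >-> R}.

Lemma sum_mfunE (I : Type) (r : seq I) (Q : pred I) (F : I -> {RV P >-> R}) (t : T) :
  (\sum_(i <- r | Q i) (F i : {mfun T >-> R})) t = \sum_(i <- r | Q i) F i t.
Proof. by elim/big_rec2: _ => //= i y1 y2 _ <-. Qed.

Lemma measurable_RV_preimage X (A : set R) : measurable A -> measurable (X @^-1` A).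
Proof. by move=> mA; rewrite -[_ @^-1` _]setTI; exact: measurable_funP. Qed.

Lemma pmfZE X (k : int) : (P (X @^-1` [set k%:~R]) = (pmfZ X k)%:E)%E.
Proof.
by rewrite /pmfZ /pmf fineK// fin_num_measure//; exact: measurable_RV_preimage.
Qed.

Lemma pmfZ_ge0 X k : 0 <= pmfZ X k.
Proof. exact: pmf_ge0. Qed.

Let floor_preimage X k : int_valued X ->
  (Num.floor \o X) @^-1` [set k] = X @^-1` [set k%:~R].
Proof.
move=> Xint; apply/seteqP; split => t /=.
  by move=> <-; rewrite floorK.
by move=> ->; rewrite intrKfloor.
Qed.

Let measurable_floor_preimage X : int_valued X ->
  forall k, measurable ((Num.floor \o X) @^-1` [set k]).
Proof. by move=> Xint k; rewrite floor_preimage//; exact: measurable_RV_preimage. Qed.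

Lemma measure_int_valued X (E : set T) : int_valued X -> measurable E ->
  (P E = \esum_(k in [set: int]) P (E `&` X @^-1` [set k%:~R]))%E.
Proof.
move=> Xint mE; rewrite (measure_fiber P (measurable_floor_preimage Xint) mE).
by apply: eq_esum => k _; rewrite floor_preimage.
Qed.

Lemma esum_pmfZ X : int_valued X -> (\esum_(k in [set: int]) (pmfZ X k)%:E = 1)%E.
Proof.
move=> Xint; rewrite -(@probability_setT _ _ _ P) (measure_int_valued Xint)//.
by apply: eq_esum => k _; rewrite setTI pmfZE.
Qed.

Lemma expectation_sqr_int_valued X (m : int) : int_valued X ->
  ('E_P[(X \- cst m%:~R) ^+ 2] =
   \esum_(k in [set: int]) ((k - m)%:~R ^+ 2 * pmfZ X k)%:E)%E.
Proof.
move=> Xint; rewrite unlock.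
transitivity (\int[P]_t (((Num.floor (X t) - m)%:~R ^+ 2)%:E : \bar R))%E.
  by apply: eq_integral => t _ /=; rewrite rmorphB/= floorK.
have /= -> := ge0_integral_fiber P (measurable_floor_preimage Xint)
  (G := fun k => (((k - m)%:~R ^+ 2)%:E : \bar R)); last first.
  by move=> k; rewrite lee_fin sqr_ge0.
apply: eq_esum => k _; rewrite [RHS]EFinM; congr (_ * _)%E.
by rewrite -pmfZE floor_preimage.
Qed.

(** Translation invariance and Var Y = E[Y^2] - (E Y)^2 for Y = X - m. *)
Lemma variance_int_valued_le X (m : int) : int_valued X ->
  ('V_P[X] <= \esum_(k in [set: int]) ((k - m)%:~R ^+ 2 * pmfZ X k)%:E)%E.
Proof.
move=> Xint; rewrite -expectation_sqr_int_valued//.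
set Y := (X \- cst m%:~R).
have mY : measurable_fun [set: T] Y by exact: measurable_funB.
(* An infinite second moment makes the bound trivial; a finite one puts [Y] in L^2, as the variance
   identities require. *)
have [->|Yfin] := eqVneq ('E_P[Y ^+ 2])%E +oo%E; first by rewrite leey.
have Y2 : Y \in Lfun P 2%:E.
  rewrite inE; apply/andP; split; rewrite inE//=.
  rewrite /finite_norm unlock poweR_lty//; move: Yfin; rewrite unlock -ltey.
  apply: le_lt_trans; rewrite le_eqVlt; apply/orP; left; apply/eqP.
  apply: eq_integral => t _.
  transitivity ((`|Y t| `^ 2%:R)%:E); first by [].
  by rewrite powR_mulrn// real_normK// num_real.
have -> : ('V_P[X] = 'V_P[(Y \+ cst m%:~R)%R])%E.
  by congr variance; apply/funext => t; rewrite /Y/= subrK.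
rewrite varianceD_cst_r// varianceE// geeDl// oppe_le0 expe2.
by case: ('E_P[Y])%E => [r| |]; rewrite -?EFinM ?lee_fin -?expr2 ?sqr_ge0.
Qed.
End random_variables.

(** * Independence of partial sums *)

Section independence.
Context {d : measure_display} {T : measurableType d} {R : realType}
  (P : probability T R).
Implicit Types Y Z : {RV P >-> R}.
Local Open Scope ereal_scope.

Lemma measurable_RV_pair Y Z : measurable_fun [set: T] (fun t => (Y t, Z t)).
Proof. by apply: measurable_fun_pair. Qed.

Lemma measurable_RV_pair_preimage Y Z (D : set (R * R)) :
  measurable D -> measurable [set t | D (Y t, Z t)].
Proof. by move=> mD; rewrite -[X in measurable X]setTI; exact: measurable_RV_pair. Qed.

(** Conditionally on [E], the law of (Y, Z) agrees with the product measure on rectangles, hence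
    everywhere by uniqueness. The case P(E) = 0 is separate because the conditional law divides by
    P(E). *)
Lemma joint_distributionE Y Z (E : set T) : measurable E ->
  (forall B C, measurable B -> measurable C ->
    P (Y @^-1` B `&` Z @^-1` C `&` E) = P (Y @^-1` B) * P (Z @^-1` C) * P E) ->
  forall D : set (R * R), measurable D ->
    P ([set t | D (Y t, Z t)] `&` E) =
    (distribution P Y \x distribution P Z) D * P E.
Proof.
move=> mE indep D mD.
have mDYZ := measurable_RV_pair_preimage Y Z mD.
have [PE0|PE0] := eqVneq (P E) 0.
  apply/eqP; rewrite PE0 mule0 eq_le measure_ge0 andbT -PE0.
  by apply: le_measure; rewrite ?inE//; exact: measurableI.
have PEfin : P E \is a fin_num by rewrite fin_num_measure.
have e0 : (0 <= (fine (P E))^-1)%R by rewrite invr_ge0 fine_ge0.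
have [mu muE] : exists mu : {measure set (R * R) -> \bar R},
    forall A, mu A = P ([set t | A (Y t, Z t)] `&` E).
  unshelve eexists (pushforward (mrestr P mE) (fun t => (Y t, Z t)) : {measure set _ -> \bar R}) => //.
  exact: measurable_RV_pair.
rewrite (@product_measure_unique _ _ _ _ R (distribution P Y) (distribution P Z)
  (mscale (NngNum e0) mu))//.
  rewrite /= /mscale/= muE muleAC -[X in _ * X * _](fineK PEfin) -EFinM mulVf ?mul1e//.
  by rewrite fine_eq0.
move=> B C mB mC; rewrite /= /mscale/= muE.
transitivity ((fine (P E))^-1%:E * (P (Y @^-1` B) * P (Z @^-1` C) * P E)).
  by rewrite -indep.
rewrite -[X in _ * (_ * X)](fineK PEfin) muleCA -EFinM mulVf ?mule1//.
by rewrite fine_eq0.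
Qed.

Lemma independent_pairE Y Z :
  (forall B C, measurable B -> measurable C ->
    P (Y @^-1` B `&` Z @^-1` C) = P (Y @^-1` B) * P (Z @^-1` C)) ->
  forall D : set (R * R), measurable D ->
    P [set t | D (Y t, Z t)] = (distribution P Y \x distribution P Z) D.
Proof.
move=> indep D mD; have := @joint_distributionE Y Z setT measurableT.
rewrite probability_setT => /(_ _ D mD); rewrite setIT mule1; apply.
by move=> B C mB mC; rewrite setIT mule1 indep.
Qed.

Section partial_sums.
Variables (n : nat) (Z : 'I_n -> {RV P >-> R}).
Hypothesis indepZ : mutually_independent Z.

(** Filtering a sum over ['I_n] keeps the index type fixed while inductions run on [k]. *)
Definition partial_sum (k : nat) : {RV P >-> R} :=
  (\sum_(i < n | (i < k)%N) (Z i : {mfun T >-> R}))%R.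

Lemma partial_sum0 t : partial_sum 0 t = 0%R.
Proof. by rewrite /partial_sum big_pred0. Qed.

Lemma partial_sumS (k : 'I_n) t : partial_sum k.+1 t = (partial_sum k t + Z k t)%R.
Proof.
rewrite !sum_mfunE [LHS](bigD1 k)//= addrC; congr (_ + _)%R.
by apply: eq_bigl => i; rewrite ltnS ltn_neqAle andbC.
Qed.

Lemma partial_sum_full : partial_sum n = sumRV Z.
Proof. by apply: eq_bigl => i; rewrite ltn_ord. Qed.

(** The induction invariant: the sum of the first [k] variables and all later variables are jointly
    independent. *)
Let independent_from (k : nat) :=
  forall (B : set R) (A : 'I_n -> set R), measurable B -> (forall i, measurable (A i)) ->
  P (partial_sum k @^-1` B `&` [set t | forall i : 'I_n, (k <= i)%N -> A i (Z i t)]) =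
  P (partial_sum k @^-1` B) * \prod_(i < n | (k <= i)%N) P (Z i @^-1` A i).

Let independent_from_pair (k : 'I_n) (B C : set R) : independent_from k ->
  measurable B -> measurable C ->
  P (partial_sum k @^-1` B `&` Z k @^-1` C) = P (partial_sum k @^-1` B) * P (Z k @^-1` C).
Proof.
move=> indepk mB mC; pose A i := if i == k then C else setT.
have mA i : measurable (A i) by rewrite /A; case: ifP.
have := indepk B A mB mA.
rewrite (bigD1 k)//= {2}/A eqxx [X in _ * (_ * X)]big1 ?mule1; last first.
  by move=> i /andP[_ /negPf ik]; rewrite /A ik preimage_setT probability_setT.
move=> <-; congr (P (_ `&` _)); apply/seteqP; split => t /=.
  by move=> Ct i _; rewrite /A; case: eqP => [->|].
by move=> /(_ k (leqnn _)); rewrite /A eqxx.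
Qed.

Let partial_sum_independent (k : nat) : (k <= n)%N -> independent_from k.
Proof.
elim: k => [|k IH] kn B A mB mA.
  have -> : partial_sum 0 @^-1` B = [set _ | B 0%R].
    by apply/seteqP; split => t /=; rewrite partial_sum0.
  have [B0|B0] := pselect (B 0%R); last first.
    rewrite (_ : [set _ | B 0%R] = set0) ?set0I ?measure0 ?mul0e//.
    by apply/seteqP; split.
  rewrite (_ : [set _ | B 0%R] = setT); last by apply/seteqP; split.
  rewrite setTI probability_setT mul1e -indepZ//; congr (P _).
  by apply/seteqP; split => t /= H i; [exact: H|move=> _; exact: H].
pose k' := Ordinal kn.
(* [E] gathers the constraints on the variables after the k-th. The invariant makes [partial_sum k],
   [Z k] and [E] independent, and [joint_distributionE] passes from rectangles to the set [D] that
   constrains the sum. *)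
pose E := [set t | forall i : 'I_n, (k.+1 <= i)%N -> A i (Z i t)].
have AE (C : set R) : measurable C -> forall B', measurable B' ->
    P (partial_sum k @^-1` B' `&` Z k' @^-1` C `&` E) =
    P (partial_sum k @^-1` B') * (P (Z k' @^-1` C) *
      \prod_(i < n | (k.+1 <= i)%N) P (Z i @^-1` A i)).
  move=> mC B' mB'; pose A' i := if i == k' then C else A i.
  have mA' i : measurable (A' i) by rewrite /A'; case: ifP.
  have := IH (ltnW kn) B' A' mB' mA'.
  rewrite (bigD1 k')//= {2}/A' eqxx.
  rewrite (eq_bigr (fun i => P (Z i @^-1` A i))); last first.
    by move=> i /andP[_ /negPf ik]; rewrite /A' ik.
  rewrite (eq_bigl (fun i : 'I_n => (k.+1 <= i)%N)); last first.
    by move=> i; rewrite [RHS]ltn_neqAle andbC eq_sym.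
  move=> <-; congr (P _); rewrite -setIA; congr (_ `&` _).
  apply/seteqP; split => t /=.
    move=> [Ct Et] i ki; rewrite /A'; case: eqP => [->//|/eqP ik].
    by apply: Et; rewrite ltn_neqAle ki andbT eq_sym.
  move=> H; split; first by have := H k' (leqnn _); rewrite /A' eqxx.
  move=> i ki; have := H i (ltnW ki); rewrite /A' ifN//.
  by apply: contraTN ki => /eqP ->; rewrite ltnn.
have PE : P E = \prod_(i < n | (k.+1 <= i)%N) P (Z i @^-1` A i).
  have := AE setT measurableT setT measurableT.
  by rewrite !preimage_setT !setTI probability_setT !mul1e.
have mE : measurable E.
  rewrite (_ : E = \bigcap_(i in [set i : 'I_n | (k < i)%N]) (Z i @^-1` A i)).
    apply: fin_bigcap_measurable => // i _; exact: measurable_RV_preimage.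
  by apply/seteqP; split => t.
have indepE B' C : measurable B' -> measurable C ->
    P (partial_sum k @^-1` B' `&` Z k' @^-1` C `&` E) =
    P (partial_sum k @^-1` B') * P (Z k' @^-1` C) * P E.
  by move=> mB' mC; rewrite AE// -PE muleA.
pose D := [set z : R * R | B (z.1 + z.2)%R].
have mD : measurable D.
  by rewrite -[D]setTI; apply: (measurable_funD measurable_fst measurable_snd).
have DE : partial_sum k.+1 @^-1` B = [set t | D (partial_sum k t, Z k' t)].
  by apply/seteqP; split => t /=; rewrite /D/= (partial_sumS k').
rewrite -PE DE (joint_distributionE mE indepE mD); congr (_ * _).
rewrite (@independent_pairE (partial_sum k) (Z k') _ D)//.
by move=> B' C mB' mC; apply: (@independent_from_pair k') => //; exact: IH (ltnW kn).
Qed.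

Lemma partial_sum_independentS (k : 'I_n) (B C : set R) :
  measurable B -> measurable C ->
  P (partial_sum k @^-1` B `&` Z k @^-1` C) = P (partial_sum k @^-1` B) * P (Z k @^-1` C).
Proof. by apply: independent_from_pair; apply: partial_sum_independent; exact: ltnW. Qed.
End partial_sums.
End independence.

(** * Mass functions of partial sums *)

Section convolution.
Context {d : measure_display} {T : measurableType d} {R : realType}
  (P : probability T R).
Variables (n : nat) (Z : 'I_n -> {RV P >-> R}).
Hypothesis indepZ : mutually_independent Z.
Hypothesis intZ : forall i, int_valued (Z i).

Lemma partial_sum_int_valued k : int_valued (partial_sum Z k).
Proof. by move=> t; rewrite sum_mfunE; apply: rpred_sum => i _; exact: intZ. Qed.

Lemma pmfZ_partial_sumS (k : 'I_n) (a : int) :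
  (\esum_(i in [set: int]) (pmfZ (Z k) i * pmfZ (partial_sum Z k) (a - i))%:E =
   (pmfZ (partial_sum Z k.+1) a)%:E)%E.
Proof.
rewrite -pmfZE (measure_int_valued (intZ k)); last exact: measurable_RV_preimage.
apply: eq_esum => i _; rewrite mulrC EFinM -!pmfZE -partial_sum_independentS//.
congr (P _); apply/seteqP; split => t /=; rewrite partial_sumS rmorphB/=.
  by move=> [-> ->]; rewrite subrK.
by move=> [<- ->]; rewrite addrK.
Qed.

Lemma partial_sum_slc k : (k <= n)%N ->
  (forall i, strongly_log_concave (pmfZ (Z i))) ->
  strongly_log_concave (pmfZ (partial_sum Z k)).
Proof.
move=> kn lcZ; elim: k kn => [_|k IH kn].
  (* The empty sum has unit mass at 0, and a = e = 0 forces b = c = 0. *)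
  have pmf0 a : a != 0 -> pmfZ (partial_sum Z 0) a = 0.
    move=> a0; rewrite /pmfZ /pmf (_ : _ @^-1` _ = set0) ?measure0//.
    apply/seteqP; split => // t /=; rewrite partial_sum0 => /esym/eqP.
    by rewrite intr_eq0 (negPf a0).
  move=> a b c e ab ac E.
  have [a0|a0] := eqVneq a 0; last by rewrite pmf0// mul0r mulr_ge0// pmfZ_ge0.
  have [e0|e0] := eqVneq e 0; last by rewrite (pmf0 e)// mulr0 mulr_ge0// pmfZ_ge0.
  suff [-> ->] : b = 0 /\ c = 0 by rewrite a0 e0.
  by split; lia.
apply: (convolution_slc _ _ (pmfZ_partial_sumS (Ordinal kn))); try exact: pmfZ_ge0.
- exact: IH (ltnW kn).
- exact: lcZ.
Qed.

(** The convolution averages the values of the mass function of [Z k] with weights that, after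
    reflection and shift, sum to 1. *)
Lemma pmfZ_partial_sum_le (k : 'I_n) (M : R) (a : int) :
  (forall i, pmfZ (Z k) i <= M) -> pmfZ (partial_sum Z k.+1) a <= M.
Proof.
move=> ZM; rewrite -lee_fin -pmfZ_partial_sumS.
have M0 : 0 <= M by apply: le_trans (ZM 0); exact: pmfZ_ge0.
apply: (@le_trans _ _ (\esum_(i in [set: int]) (M%:E * (pmfZ (partial_sum Z k) (a - i))%:E)))%E.
  apply: le_esum => i _; rewrite -EFinM lee_fin ler_wpM2r//; exact: pmfZ_ge0.
have S0 i : (0 <= (pmfZ (partial_sum Z k) i)%:E)%E by rewrite lee_fin pmfZ_ge0.
rewrite esumZl//.
rewrite (esum_opp (fun i => (pmfZ (partial_sum Z k) (a + i))%:E)).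
under eq_esum do rewrite addrC.
rewrite (esum_shift a (fun i => (pmfZ (partial_sum Z k) i)%:E)).
by rewrite esum_pmfZ ?mule1//; exact: partial_sum_int_valued.
Qed.
End convolution.

(** * Smoothing by uniform variables *)

Section density.
Context {d : measure_display} {T : measurableType d} {R : realType}
  (P : probability T R).
Local Notation mu := (@lebesgue_measure R).
Local Open Scope ereal_scope.

Lemma lebesgue_measure_translation (y : R) (A : set R) : measurable A ->
  mu [set u | A (y + u)%R] = mu A.
Proof.
move=> mA; pose shift (u : measurableTypeR R) : measurableTypeR R := (y + u)%R.
have mshift : measurable_fun [set: measurableTypeR R] shift.
  by apply: measurable_funD.
have [nu nuE] : exists nu : {measure set (measurableTypeR R) -> \bar R},
    forall A, nu A = mu [set u | A (y + u)%R].
  by unshelve eexists (pushforward mu shift : {measure set (measurableTypeR R) -> \bar R}).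
rewrite -nuE; apply/esym; apply: lebesgue_measure_unique => // X [[a b] /= ab <-].
have E : [set u | `]a, b]%classic (y + u)%R] = `](a - y)%R, (b - y)%R]%classic.
  by apply/seteqP; split => u /=; rewrite !in_itv/= ltrBlDl lerBrDl.
rewrite nuE E.
by rewrite !lebesgue_measure_itv/= !lte_fin ltrD2r -!EFinB opprB addrA subrK.
Qed.

Lemma uniform01E (A : set R) : measurable A ->
  uniform_prob (@ltr01 R) A = mu (A `&` `[0%R, 1%R]).
Proof.
move=> mA; rewrite /uniform_prob integral_uniform_pdf.
rewrite (eq_integral (cst 1)); last first.
  by move=> x; rewrite inE => -[_ /=]; rewrite in_itv/= /uniform_pdf => ->; rewrite subr0 invr1.
by rewrite integral_cst ?mul1e//; exact: measurableI.
Qed.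

(* The y-section at x of this set is the window ]x - 1, x]: Fubini applied to it
   and to the law of Y times Lebesgue measure gives the density of Y + U. *)
Definition unit_window : set (R * R) := [set z | z.1 <= z.2 < z.1 + 1]%R.

Lemma measurable_unit_window : measurable unit_window.
Proof.
rewrite (_ : unit_window = [set z | z.1 <= z.2]%R `&` [set z | z.2 < z.1 + 1]%R).
  apply: measurableI.
    have := @measurable_fun_ler _ (R * R)%type R setT fst snd measurable_fst measurable_snd.
    by move=> /(_ measurableT [set true] I); rewrite setTI.
  have := @measurable_fun_ltr _ (R * R)%type R setT snd (fun z => z.1 + 1)%R measurable_snd.
  move=> /(_ (measurable_funD measurable_fst (measurable_cst _))).
  by move=> /(_ measurableT [set true] I); rewrite setTI.
by apply/seteqP; split => z /=; [move=> /andP|move=> ?; apply/andP].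
Qed.

Variables Y U : {RV P >-> R}.
Hypothesis uniU : uniform01 U.
Hypothesis indepYU : forall B C, measurable B -> measurable C ->
  P (Y @^-1` B `&` U @^-1` C) = P (Y @^-1` B) * P (U @^-1` C).

(** The value at [x] of the density of Y + U; for the sum W of the other uniform variables it later
    serves as a weight on lattice points. *)
Definition window_prob (x : R) : R := fine (P [set t | x - 1 < Y t <= x]%R).

Lemma measurable_window x : measurable [set t | x - 1 < Y t <= x]%R.
Proof.
rewrite (_ : [set t | _] = Y @^-1` `](x - 1)%R, x]); first exact: measurable_RV_preimage.
by apply/seteqP; split => t /=; rewrite in_itv.
Qed.

Lemma window_probE x : (window_prob x)%:E = distribution P Y (ysection unit_window x).
Proof.
rewrite /window_prob fineK; last by rewrite fin_num_measure//; exact: measurable_window.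
congr (P _); apply/seteqP; split => t /=; rewrite /ysection/= inE/= ltrBlDr.
  by rewrite andbC.
by rewrite andbC.
Qed.

Lemma window_prob_density : is_density (addRV Y U) window_prob.
Proof.
have mW := measurable_unit_window.
split=> [|x|A mA]; last 1 first.
- pose D := [set z : R * R | A (z.1 + z.2)%R].
  have mD : measurable D.
    by rewrite -[D]setTI; apply: (measurable_funD measurable_fst measurable_snd).
  (* The change of variable x = y + u: [D] lives in the (y, u) plane and [D'] in the (y, x)
     plane. *)
  pose D' := unit_window `&` [set z | A z.2].
  have mD' : measurable D'.
    apply: measurableI => //; rewrite -[X in measurable X]setTI.
    exact: measurable_snd.
  transitivity (P [set t | D (Y t, U t)]); first by [].
  rewrite (independent_pairE indepYU mD).
  transitivity ((distribution P Y \x mu) D').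
    apply: eq_integral => y _ /=; rewrite uniU; last exact: measurable_xsection.
    rewrite uniform01E; last exact: measurable_xsection.
    (* The interval [y, y + 1] is cut at its right endpoint, a null set, to match the half-open
       [unit_window]. *)
    have mA1 : measurable (A `&` `[y, (y + 1)%R[) by exact: measurableI.
    have mA2 : measurable (A `&` [set (y + 1)%R]) by exact: measurableI.
    transitivity (mu ((A `&` `[y, (y + 1)%R[) `|` (A `&` [set (y + 1)%R]))).
      rewrite -(lebesgue_measure_translation y (measurableU _ _ mA1 mA2)).
      congr (mu _); apply/seteqP; split => u /=; rewrite /xsection/= inE/= !in_itv/=.
        move=> [Ayu /andP[u0 u1]]; have [u1'|u1'] := ltP u 1%R; [left|right]; split => //.
          by rewrite lerDl u0 ltrD2l.
        by congr (_ + _)%R; apply/eqP; rewrite eq_le u1 u1'.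
      move=> [[Ayu]|[Ayu /addrI u1]]; last by split => //; rewrite u1 ler01 lexx.
      move=> H; split=> //; move: H.
      by rewrite lerDl ltrD2l => /andP[-> /ltW ->].
    transitivity (mu (A `&` `[y, (y + 1)%R[)).
      apply: measureU0; [exact: mA1|exact: mA2|].
      apply/eqP; rewrite eq_le measure_ge0 andbT -(lebesgue_measure_set1 (y + 1)%R).
      by apply: le_measure; rewrite ?inE.
    congr (mu _); apply/seteqP; split => x; rewrite /xsection/= inE/= in_itv/=.
      by move=> [].
    by move=> [].
  (* Fubini: from here the y-sections at fixed [x] are integrated. *)
  rewrite (@product_measure_unique _ _ _ _ R (distribution P Y) mu
    (distribution P Y \x^ mu))//; last first.
    by move=> B C mB mC; exact: product_measure2E.
  rewrite [RHS]integral_mkcond; apply: eq_integral => x _ /=.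
  rewrite patchE window_probE; case: ifPn => [|nA].
    rewrite inE => Ax; congr (P _); apply/seteqP; split => t /=; rewrite /ysection/= !inE/=.
      by move=> [].
    by [].
  rewrite (_ : ysection D' x = set0) ?measure0//.
  apply/seteqP; split => // y; rewrite /ysection/= inE => -[_ /=].
  by rewrite notin_setE in nA.
- rewrite (_ : window_prob = fine \o (fun x => distribution P Y (ysection unit_window x))).
    by apply: measurableT_comp => //; exact: measurable_fun_ysection.
  by apply/funext => x /=; rewrite -window_probE.
- by rewrite /window_prob fine_ge0.
Qed.
End density.

(** * The density of the smoothed sum as a weighted mean *)

Section smoothed_sum.
Context {d : measure_display} {T : measurableType d} {R : realType}
  (P : probability T R).
Variables (s : nat) (X U : 'I_s.+1 -> {RV P >-> R}).
Hypothesis intX : forall i, int_valued (X i).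
Hypothesis indepU : mutually_independent U.
Hypothesis uniU : forall i, uniform01 (U i).
Hypothesis indepXU : independent_vectors X U.
Local Open Scope ereal_scope.

Let S := sumRV X.
Let W := partial_sum U s.
Let Y := addRV S W.

Let intS : int_valued S.
Proof. by rewrite /S -partial_sum_full; exact: partial_sum_int_valued. Qed.

Lemma sumRV_recr : addRV S (sumRV U) = addRV Y (U ord_max).
Proof.
rewrite /Y /addRV /sumRV -addrA; congr (_ + _)%R.
rewrite (bigD1 ord_max)//= addrC; congr (_ + _)%R.
apply: eq_bigl => i; rewrite ltn_neqAle -ltnS ltn_ord andbT.
by [].
Qed.

Let measurable_tuple_sum (m : nat) (Q : pred 'I_m) (A : set R) : measurable A ->
  measurable [set t : m.-tuple R | A (\sum_(i < m | Q i) tnth t i)%R].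
Proof.
move=> mA; rewrite -[X in measurable X]setTI.
have : measurable_fun [set: m.-tuple R] (fun t => \sum_(i < m | Q i) tnth t i)%R.
  under eq_fun do rewrite big_mkcond/=.
  by apply: measurable_sum => i; case: (Q i) => //; exact: measurable_tnth.
by apply.
Qed.

Lemma independent_sums (A B C : set R) : measurable A -> measurable B -> measurable C ->
  P (S @^-1` A `&` (W @^-1` B `&` U ord_max @^-1` C)) =
  P (S @^-1` A) * P (W @^-1` B `&` U ord_max @^-1` C).
Proof.
move=> mA mB mC.
(* All three events concern sums of coordinates; the last coordinate of [U] is the sum over
   [pred1 ord_max]. *)
have := indepXU (measurable_tuple_sum xpredT mA)
  (measurableI _ _ (measurable_tuple_sum (fun i : 'I_s.+1 => (i < s)%N) mB)
    (measurable_tuple_sum (pred1 ord_max) mC)).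
have sumE (Z : 'I_s.+1 -> {RV P >-> R}) (Q : pred 'I_s.+1) t :
    (\sum_(i < s.+1 | Q i) tnth (random_vector Z t) i = \sum_(i < s.+1 | Q i) Z i t)%R.
  by apply: eq_bigr => i _; rewrite tnth_mktuple.
rewrite (_ : random_vector X @^-1` _ = S @^-1` A); last first.
  by apply/seteqP; split => t /=; rewrite sumE sum_mfunE.
rewrite (_ : random_vector U @^-1` _ = W @^-1` B `&` U ord_max @^-1` C)//.
by apply/seteqP; split => t /=; rewrite !sumE sum_mfunE big_pred1_eq.
Qed.

Let independent_S_W (A B : set R) : measurable A -> measurable B ->
  P (S @^-1` A `&` W @^-1` B) = P (S @^-1` A) * P (W @^-1` B).
Proof.
by move=> mA mB; have := independent_sums mA mB measurableT; rewrite preimage_setT setIT.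
Qed.

Let independent_W_U (B C : set R) : measurable B -> measurable C ->
  P (W @^-1` B `&` U ord_max @^-1` C) = P (W @^-1` B) * P (U ord_max @^-1` C).
Proof. exact: (partial_sum_independentS indepU ord_max). Qed.

Let measurable_shift (B : set R) (y : R) : measurable B ->
  measurable [set w | B (y + w)%R].
Proof.
move=> mB; rewrite -[X in measurable X]setTI.
have : measurable_fun [set: R] (fun w : R => y + w)%R by exact: measurable_funD.
by apply.
Qed.

(** Decompose by the value k of the discrete variable [S]: on S = k the event Y in B constrains only
    [W], and each piece factors. *)
Lemma independent_Y_U (B C : set R) : measurable B -> measurable C ->
  P (Y @^-1` B `&` U ord_max @^-1` C) = P (Y @^-1` B) * P (U ord_max @^-1` C).
Proof.
move=> mB mC; have mBk k := measurable_shift k%:~R mB.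
rewrite (measure_int_valued intS); last first.
  by apply: measurableI; exact: measurable_RV_preimage.
rewrite [in RHS](measure_int_valued intS); last exact: measurable_RV_preimage.
have Ufin : P (U ord_max @^-1` C) \is a fin_num.
  by rewrite fin_num_measure//; exact: measurable_RV_preimage.
rewrite -[in RHS](fineK Ufin) muleC -esumZl ?fine_ge0//.
apply: eq_esum => k _.
transitivity (P (S @^-1` [set k%:~R] `&`
    (W @^-1` [set w | B (k%:~R + w)%R] `&` U ord_max @^-1` C))).
  congr (P _); apply/seteqP; split => t /=.
    by move=> [[BY CU] <-].
  by move=> [Sk [BW CU]]; rewrite -Sk in BW.
rewrite independent_sums// independent_W_U// muleA fineK// [RHS]muleC.
congr (_ * _); rewrite -independent_S_W//.
congr (P _); apply/seteqP; split => t /=.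
  by move=> [Sk BW]; rewrite -Sk in BW.
by move=> [BY Sk]; rewrite -Sk.
Qed.

Lemma smoothed_sum_density : is_density (addRV S (sumRV U)) (window_prob Y).
Proof. by rewrite sumRV_recr; apply: window_prob_density => //; exact: independent_Y_U. Qed.

Let ae_unit : {ae P, forall t, forall i, (0 <= U i t <= 1)%R}.
Proof.
apply: filter_forall => i; exists (U i @^-1` ~` `[0%R, 1%R]); split.
- by apply: measurable_RV_preimage; exact: measurableC.
- have := uniU i (measurableC (measurable_itv `[0%R, 1%R])).
  by rewrite uniform01E ?setICl ?measure0//; exact: measurableC.
- by move=> t /=; rewrite in_itv.
Qed.

Let ae_W : {ae P, forall t, (0 <= W t <= s%:R)%R}.
Proof.
apply: filterS ae_unit => t H; rewrite sum_mfunE; apply/andP; split.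
  by apply: sumr_ge0 => i _; have /andP[] := H i.
rewrite big_mkcond big_ord_recr/= ltnn addr0.
apply: (@le_trans _ _ (\sum_(i < s) 1)%R); last by rewrite sumr_const card_ord.
by apply: ler_sum => i _; rewrite ltn_ord; have /andP[] := H (widen_ord (leqnSn s) i).
Qed.

(** The window ]y - 1, y] misses [0, s], where [W] lies almost surely. Its open left end covers y =
    s + 1, which leaves s + 1 possible indices rather than s + 2. *)
Let window_prob_W0 (y : R) : (y < 0)%R || (s%:R + 1 <= y)%R -> window_prob W y = 0%R.
Proof.
move=> ys; rewrite /window_prob; suff -> : P [set t | y - 1 < W t <= y]%R = 0 by [].
apply: measure_negligible; first exact: measurable_window.
apply: negligibleS ae_W => t /= /andP[W1 W2]; apply/negP; rewrite negb_and -!ltNge.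
by case/orP: ys => H; [rewrite (le_lt_trans W2)|apply/orP; right; lra].
Qed.

(** The windows ]x - i - 1, x - i] partition the line; they are the fibers of floor(x - W). *)
Let esum_window_prob_W (x : R) :
  \esum_(i in [set: int]) (window_prob W (x - i%:~R))%:E = 1.
Proof.
pose phi t := Num.floor (x - W t).
have phiE i : phi @^-1` [set i] = [set t | x - i%:~R - 1 < W t <= x - i%:~R]%R.
  apply/seteqP; split => t /=.
    move=> <-; have := floor_itv (x - W t)%R; rewrite intrD => /andP[a b].
    by apply/andP; split; move: a b; rewrite /phi; lra.
  by move=> /andP[a b]; apply: floor_def; rewrite intrD; apply/andP; split; lra.
have mphi i : measurable (phi @^-1` [set i]) by rewrite phiE; exact: measurable_window.
rewrite -(@probability_setT _ _ _ P) (measure_fiber P mphi)//.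
apply: eq_esum => i _; rewrite setTI phiE fineK// fin_num_measure//.
exact: measurable_window.
Qed.

Lemma window_probYE (x : R) :
  (window_prob Y x)%:E =
  \esum_(i in [set: int]) (pmfZ S i * window_prob W (x - i%:~R))%:E.
Proof.
rewrite /window_prob fineK; last by rewrite fin_num_measure//; exact: measurable_window.
rewrite (measure_int_valued intS); last exact: measurable_window.
apply: eq_esum => i _; rewrite EFinM -pmfZE fineK; last first.
  by rewrite fin_num_measure//; exact: measurable_window.
have E : [set t | x - i%:~R - 1 < W t <= x - i%:~R]%R =
    W @^-1` `](x - i%:~R - 1)%R, (x - i%:~R)%R].
  by apply/seteqP; split => t /=; rewrite in_itv.
rewrite E -independent_S_W// -E; congr (P _); apply/seteqP; split => t /=.
  move=> [YW Si]; split => //; move: (YW : (x - 1 < S t + W t <= x)%R).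
  by rewrite Si => /andP[a b]; apply/andP; split; lra.
move=> [Si /andP[a b]]; split => //; suff : (x - 1 < S t + W t <= x)%R by [].
by rewrite Si; apply/andP; split; lra.
Qed.

Let window_index (x : R) (i : int) : window_prob W (x - i%:~R) != 0%R ->
  exists2 j, (j <= s)%N & i = (Num.floor x - j%:Z)%R.
Proof.
move=> c0; have /andP[x0 xs] : (0 <= x - i%:~R < s%:R + 1)%R.
  apply: contraNT c0 => H; apply/eqP/window_prob_W0.
  by move: H; rewrite negb_and -ltNge -leNgt.
have /andP[kx xk] := floor_itv x.
have ik : (i%:~R < (Num.floor x + 1)%:~R :> R)%R by lra.
have ki : ((Num.floor x)%:~R < (s%:Z + 1 + i)%:~R :> R)%R by rewrite !rmorphD/=; lra.
by rewrite !ltr_int in ik ki; exists (absz (Num.floor x - i)%R); lia.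
Qed.

Lemma windowed_window_prob (x : R) :
  windowed (pmfZ S) s (window_prob Y x) (Num.floor x).
Proof.
have c0 y : (0 <= window_prob W y)%R by rewrite fine_ge0.
have c0E i : 0 <= (window_prob W (x - i%:~R))%:E by rewrite lee_fin.
split=> c cp; rewrite -lee_fin window_probYE.
  have c_ge0 : (0 <= c)%R by apply: le_trans (cp 0%N isT); exact: pmfZ_ge0.
  rewrite -[leRHS]mule1 -(esum_window_prob_W x) -esumZl//.
  apply: le_esum => i _; rewrite -EFinM lee_fin.
  have [->|/window_index[j js ->]] := eqVneq (window_prob W (x - i%:~R)) 0%R.
    by rewrite !mulr0.
  by rewrite ler_wpM2r// cp.
(* [esumZl] takes a nonnegative factor; a negative lower bound holds trivially. *)
have [c_lt0|c_ge0] := ltP c 0%R.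
  apply: (@le_trans _ _ 0); first by rewrite lee_fin ltW.
  by apply: esum_ge0 => i _; rewrite lee_fin mulr_ge0// pmfZ_ge0.
rewrite -[leLHS]mule1 -(esum_window_prob_W x) -esumZl//.
apply: le_esum => i _; rewrite -EFinM lee_fin.
have [->|/window_index[j js ->]] := eqVneq (window_prob W (x - i%:~R)) 0%R.
  by rewrite !mulr0.
by rewrite ler_wpM2r// cp.
Qed.
End smoothed_sum.

(** * Comparison of the entropies *)

Section entropy_gap.
Context {R : realType}.

(** Densities of one law agree almost everywhere, so the entropy may be computed from [g]; as g <=
    1, eta(g) is nonnegative and the sign passes through the integral. *)
Lemma differential_entropyE (d : measure_display) (T : measurableType d)
    (P : probability T R) (Y : {RV P >-> R}) (f g : R -> R) :
  is_density Y f -> is_density Y g -> (forall x, g x <= 1) ->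
  differential_entropy f = (\int[lebesgue_measure]_x (eta (g x))%:E)%E.
Proof.
move=> [mf f0 fP] [mg g0 gP] g1.
have fint : (@lebesgue_measure R).-integrable setT (EFin \o f).
  apply/integrableP; split; first exact/measurable_EFinP.
  apply: (@le_lt_trans _ _ (distribution P Y setT)); last first.
    by rewrite probability_setT ltry.
  rewrite (fP setT measurableT) le_eqVlt; apply/orP; left; apply/eqP.
  by apply: eq_integral => x _; rewrite /= ger0_norm.
have fg : ae_eq (@lebesgue_measure R) setT (EFin \o f) (EFin \o g).
  apply: integral_ae_eq => //; first exact/measurable_EFinP.
  by move=> E _ mE; rewrite -fP// -gP.
have mln (h : R -> R) : measurable_fun [set: R] h ->
    measurable_fun [set: R] (fun x => (h x * ln (h x))%:E).
  move=> mh; apply/measurable_EFinP; apply: measurable_funM => //.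
  exact: measurableT_comp (@measurable_ln R) mh.
transitivity (- \int[lebesgue_measure]_x (g x * ln (g x))%:E)%E.
  congr (- _)%E; apply: ae_eq_integral => //; [exact: mln|exact: mln|].
  by apply: filterS fg => x /(_ I)[] /= + _ => ->.
transitivity (- \int[lebesgue_measure]_x (- (eta (g x))%:E))%E.
  by congr (- _)%E; apply: eq_integral => x _; rewrite -EFinN /eta opprK.
by rewrite integral_ge0N ?oppeK// => x _; rewrite lee_fin eta_ge0// g0 g1.
Qed.

(** The number [c] bounds the maximum M of the last summand's mass function: v <= 72 / M^2 and 72 <=
    c^2 v give M <= c. *)
Lemma entropy_gap (d : measure_display) (T : measurableType d) (P : probability T R)
    (s : nat) (X U : 'I_s.+1 -> {RV P >-> R}) (f : R -> R) (v c : R) :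
  log_concave_setup X U v -> is_density (addRV (sumRV X) (sumRV U)) f ->
  0 < v -> 0 <= c -> 72 <= c ^+ 2 * v -> c <= expR (- 1) ->
  (`| differential_entropy f - shannon_entropy (sumRV X) | <= (s%:R * eta c)%:E)%E.
Proof.
move=> [[[indepX _] lcX] varX [[indepU _] uniU] indepXU] fd v0 c0 vc ce.
have intX i : int_valued (X i) := (lcX i).1.
have slcX i : strongly_log_concave (pmfZ (X i)).
  have [_ [lc supp]] := lcX i.
  by apply: strongly_log_concaveP => // k; exact: pmfZ_ge0.
have pX0 i k : 0 <= pmfZ (X i) k by exact: pmfZ_ge0.
have [mX [MX0 MX]] := pmf_mode (pX0 ord_max) (esum_pmfZ (intX ord_max)).
have MXc : pmfZ (X ord_max) mX <= c.
  have := variance_int_valued_le mX (intX ord_max); rewrite varX.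
  move=> /le_trans/(_ (second_moment_le (pX0 _) (esum_pmfZ (intX _)) (slcX _) MX0 MX)).
  rewrite lee_fin ler_pdivlMr ?exprn_gt0// => vM.
  rewrite -(@ler_pXn2r _ 2)// ?nnegrE//.
  by rewrite -(ler_pM2r v0) mulrC (le_trans vM).
have SE : partial_sum X s.+1 = sumRV X by exact: partial_sum_full.
have intS : int_valued (sumRV X) by rewrite -SE; exact: partial_sum_int_valued.
have pS0 k : 0 <= pmfZ (sumRV X) k by exact: pmfZ_ge0.
have pS1 := esum_pmfZ intS.
have slcS : strongly_log_concave (pmfZ (sumRV X)) by rewrite -SE; exact: partial_sum_slc.
have Sc k : pmfZ (sumRV X) k <= c.
  by rewrite -SE; apply: (@pmfZ_partial_sum_le _ _ _ _ _ X _ _ ord_max) => // i; exact: le_trans MXc.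
have [m [M0 M]] := pmf_mode pS0 pS1.
have gd := smoothed_sum_density intX indepU uniU indepXU.
have gw := windowed_window_prob intX uniU indepXU.
have g1 x : window_prob (addRV (sumRV X) (partial_sum U s)) x <= 1.
  rewrite /window_prob -lee_fin fineK ?probability_le1//; last first.
    by rewrite fin_num_measure//; exact: measurable_window.
  exact: measurable_window.
rewrite (differential_entropyE fd gd g1); have [mg g0 _] := gd.
apply: le_trans (windowed_entropy_le pS0 pS1 slcS M0 M (le_trans (Sc m) ce) mg g0 gw) _.
by rewrite lee_fin ler_wpM2l// eta_le.
Qed.

End entropy_gap.

(** * Numerical estimates *)

Section constants.
Context {R : realType}.

Lemma expRN1_ge : 1 / 4 <= expR (- 1) :> R.
Proof.
rewrite (_ : -1 = - 2^-1 + - 2^-1 :> R); last by field.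
by rewrite expRD; have := @expR_ge1Dx R (- 2^-1); nra.
Qed.

(** The square of 9 s sqrt(s + 1) <= 2^(s + 3). The left side at most quadruples per step from s = 2
    on; smaller cases are computed. *)
Lemma window_constant_le (s : nat) : (81 * s ^ 2 * s.+1 <= 4 ^ (s + 3))%N.
Proof.
case: s => [//|[//|s]].
elim: s => [//|s IH]; rewrite addSn expnS.
apply: leq_trans (leq_mul (leqnn 4) IH); nia.
Qed.

(** Since 1296 = 36^2, each alternative is the square of an inequality that yields sigma >= 36 from
    one of the two lower bounds on sigma sqrt n. *)
Lemma variance_threshold_le (n : nat) :
  (1296 * n <= 3 ^ 14)%N || (1296 * n <= 4 ^ (n + 2))%N.
Proof.
have [n5|n5] := leqP n 5.
  by apply/orP; left; apply: (@leq_trans (1296 * 5)); rewrite ?leq_mul2l.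
apply/orP; right; have -> : n = (n - 5 + 5)%N by rewrite subnK// ltnW.
elim: (n - 5)%N => [//|k IH]; rewrite !addSn expnS.
have : (1 <= 4 ^ (k + 5 + 2))%N by rewrite expn_gt0.
move: IH; set w := (4 ^ _)%N; nia.
Qed.

(** As eta(9 / sigma) = (9 / sigma) ln(sigma / 9), coefficients compare by 9 s sqrt(s + 1) <= 2^(s +
    3) and logarithms by monotonicity. *)
Lemma eta_bound (s : nat) (sigma : R) : 36 <= sigma ->
  s%:R * eta (9 / sigma) <=
  2 ^+ (s.+1 + 2) / (sigma * Num.sqrt s.+1%:R)
    * ln (2 ^+ (s.+1 + 2) * sigma * Num.sqrt s.+1%:R).
Proof.
move=> sigma36; have sigma0 : 0 < sigma by lra.
set r := Num.sqrt s.+1%:R; set K := 2 ^+ (s.+1 + 2).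
have r1 : 1 <= r by rewrite -(sqrtr1 R) ler_sqrt// ler1n.
have K1 : 1 <= K by rewrite exprn_ege1// ler1n.
have sK : 9 * s%:R * r <= K.
  rewrite -(@ler_pXn2r _ 2)// ?nnegrE ?mulr_ge0//; try lra.
  rewrite exprMn sqr_sqrtr// /K -exprM mulnC exprM -!natrX -natrM -natrX -natrM ler_nat.
  apply: leq_trans (_ : 81 * s ^ 2 * s.+1 <= _)%N; first by rewrite expnMn.
  by have := window_constant_le s; rewrite addSnnS.
rewrite /eta (_ : - _ = 9 / sigma * ln (sigma / 9)); last first.
  by rewrite -[9 / sigma]invf_div lnV ?posrE ?divr_gt0// mulrN opprK.
have lnle : ln (sigma / 9) <= ln (K * sigma * r).
  rewrite ler_ln ?posrE ?divr_gt0// ?mulr_gt0//; try lra.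
  have : sigma <= K * sigma by nra.
  have : 0 < K * sigma by nra.
  by nra.
have ln0 : 0 <= ln (K * sigma * r).
  apply: le_trans lnle; rewrite ln_ge0// ler_pdivlMr; lra.
rewrite mulrA; apply: (@le_trans _ _ (s%:R * (9 / sigma) * ln (K * sigma * r))).
  by rewrite ler_wpM2l// mulr_ge0// divr_ge0// ltW.
rewrite ler_wpM2r//.
rewrite ler_pdivlMr ?mulr_gt0//; last lra.
rewrite (_ : _ * _ * _ = 9 * s%:R * r)//; field; lra.
Qed.
End constants.

Theorem theorem1 (R : realType) (n : nat) (hn : (1 <= n)%N) :
  (* the sum X_1 + ... + X_n + U_1 + ... + U_n has a density *)
  (forall (d : measure_display) (T : measurableType d) (P : probability T R)
     (X U : 'I_n -> {RV P >-> R}) (v : R),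
     log_concave_setup X U v ->
     exists f : R -> R, is_density (addRV (sumRV X) (sumRV U)) f)
  /\
  (* o(1) as the variance v tends to infinity, n being fixed *)
  (forall eps : R, 0 < eps ->
     \forall v \near +oo,
     forall (d : measure_display) (T : measurableType d) (P : probability T R)
       (X U : 'I_n -> {RV P >-> R}) (f : R -> R),
       log_concave_setup X U v ->
       is_density (addRV (sumRV X) (sumRV U)) f ->
       (`| differential_entropy f - shannon_entropy (sumRV X) | <= eps%:E)%E)
  /\
  (* the explicit bound *)
  (forall (d : measure_display) (T : measurableType d) (P : probability T R)
     (X U : 'I_n -> {RV P >-> R}) (f : R -> R) (sigma : R),
     0 <= sigma ->
     log_concave_setup X U (sigma ^+ 2) ->
     is_density (addRV (sumRV X) (sumRV U)) f ->
     Num.max (2 ^+ (n + 2) / Num.sqrt n%:R) (3 ^+ 7 / Num.sqrt n%:R) < sigma ->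
     (`| differential_entropy f - shannon_entropy (sumRV X) | <=
       (2 ^+ (n + 6) * expR (- ((Num.sqrt n%:R * sigma) `^ (5%:R^-1)))
          * (Num.sqrt n%:R * sigma) ^+ 3
        + 2 ^+ (n + 2) / (sigma * Num.sqrt n%:R)
          * ln (2 ^+ (n + 2) * sigma * Num.sqrt n%:R)
        + ln (n%:R * sigma ^+ 2) / (8 * n%:R * sigma ^+ 2))%:E)%E).

Proof.
case: n hn => [//|s] _; split; last split.
- move=> d T P X U v [[[_ _] lcX] _ [[indepU _] uniU] indepXU].
  exists (window_prob (addRV (sumRV X) (partial_sum U s))).
  apply: smoothed_sum_density => // i; exact: (lcX i).1.
- move=> eps eps0.
  (* The bound 1/4 keeps c below exp(-1); the other gives 2 sqrt c <= eps / (s + 1), hence s eta(c)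
     <= eps. *)
  pose c : R := Num.min (1 / 4) ((eps / (2 * s.+1%:R)) ^+ 2).
  have c0 : 0 < c by rewrite lt_min divr_gt0// exprn_gt0// divr_gt0// mulr_gt0.
  have ce : c <= expR (- 1) by rewrite (le_trans _ expRN1_ge)// ge_min lexx.
  near=> v => d T P X U f setup fd.
  have v0 : 0 < v by near: v; apply: nbhs_pinfty_gt; exact: num_real.
  have vc : 72 <= c ^+ 2 * v.
    by rewrite -ler_pdivrMl ?exprn_gt0.
  apply: le_trans (entropy_gap setup fd v0 (ltW c0) vc ce) _; rewrite lee_fin.
  apply: (@le_trans _ _ (s%:R * (2 * (eps / (2 * s.+1%:R))))).
    rewrite ler_wpM2l// (le_trans (eta_le_sqrt (ltW c0)))// ler_wpM2l//.
    set t := eps / _; have t0 : 0 <= t by rewrite divr_ge0// ltW.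
    rewrite -(ger0_norm t0) -sqrtr_sqr; apply: ler_wsqrtr.
    by rewrite ge_min lexx orbT.
  have simp (a b e : R) : b != 0 -> a * (2 * (e / (2 * b))) = e * (a / b).
    by move=> b0; field.
  rewrite simp ?pnatr_eq0//.
  apply: ler_piMr; first exact: ltW.
  by rewrite ler_pdivrMr// mul1r ler_nat.
- move=> d T P X U f sigma sigma_ge0 setup fd; rewrite gt_max => /andP[sigma1 sigma2].
  set r := Num.sqrt s.+1%:R in sigma1 sigma2 *.
  have r1 : 1 <= r by rewrite -(sqrtr1 R) ler_sqrt// ler1n.
  have r0 : 0 < r by lra.
  have n0 : (0 : R) <= s.+1%:R by [].
  have sigma36 : 36 <= sigma.
    have sr0 : 0 <= sigma * r by rewrite mulr_ge0// ltW.
    have rr : r ^+ 2 = s.+1%:R by rewrite sqr_sqrtr.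
    move: sigma1 sigma2; rewrite !ltr_pdivrMr// => sigma1 sigma2.
    rewrite -(@ler_pXn2r _ 2)// ?nnegrE// -(@ler_pM2r _ (r ^+ 2)) ?exprn_gt0//.
    rewrite -[leRHS]exprMn rr -natrX -natrM.
    have /orP[le|le] := variance_threshold_le s.+1.
      apply: (@le_trans _ _ ((3 ^+ 7) ^+ 2)).
        by rewrite -exprM -natrX ler_nat.
      by apply: lerXn2r (ltW sigma2); rewrite nnegrE// exprn_ge0.
    apply: (@le_trans _ _ ((2 ^+ (s.+1 + 2)) ^+ 2)).
      by rewrite -exprM [((_ + 2) * 2)%N]mulnC exprM -!natrX ler_nat.
    by apply: lerXn2r (ltW sigma1); rewrite nnegrE// exprn_ge0.
  have sigma0 : 0 < sigma by lra.
  (* Here c = 9 / sigma, since 9^2 >= 72; sigma >= 36 makes it at most 1/4. *)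
  have c0 : 0 <= 9 / sigma by rewrite divr_ge0.
  have ce : 9 / sigma <= expR (- 1).
    by apply: le_trans expRN1_ge; rewrite ler_pdivrMr//; lra.
  have vc : 72 <= (9 / sigma) ^+ 2 * sigma ^+ 2.
    by rewrite -exprMn divfK ?gt_eqF//; lra.
  apply: le_trans (entropy_gap setup fd (exprn_gt0 2 sigma0) c0 vc ce) _.
  rewrite lee_fin; apply: le_trans (eta_bound s sigma36) _.
  (* [eta_bound] gives the middle term; the outer ones are nonnegative, the last because n sigma^2
     >= 1. *)
  rewrite addrAC lerDr; apply: addr_ge0.
    apply: mulr_ge0; first by apply: mulr_ge0; [exact: exprn_ge0|exact: expR_ge0].
    by apply: exprn_ge0; rewrite mulr_ge0// ltW.
  have n1 : 1 <= s.+1%:R :> R by rewrite ler1n.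
  apply: divr_ge0; first by rewrite ln_ge0//; nra.
  by rewrite !mulr_ge0// exprn_ge0// ltW.
Unshelve. all: by end_near.
Qed.
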